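(* Assume that $\mu_0,\widehat\lambda_0\in L^\infty(\Omega)$, $\sum_{j\ge1}\|\psi_j\|_{L^\infty(\Omega)}<\infty$ and $\sum_{j\ge1}\|\phi_j\|_{L^\infty(\Omega)}<\infty$. For $\mathbf f\in\mathbf V^*$, $\boldsymbol r=(\boldsymbol y,\boldsymbol z)\in U\times U$ and $\mathbf s=(s_1,s_2)\in\mathbb N^2$, let $\mathbf u(\cdot,\boldsymbol r)\in\mathbf V$ be the solution of $\mathcal B(\boldsymbol r;\mathbf u(\cdot,\boldsymbol r),\mathbf v)=\ell(\mathbf v)$ for all $\mathbf v\in\mathbf V$, and let $\mathbf u_{\mathbf s}(\cdot,\boldsymbol r^{\mathbf s})\in\mathbf V$ be the solution of the truncated problem $\mathcal B(\boldsymbol r^{\mathbf s};\mathbf u_{\mathbf s}(\cdot,\boldsymbol r^{\mathbf s}),\mathbf v)=\ell(\mathbf v)$ for all $\mathbf v\in\mathbf V$. Let $\mathcal L$ be a linear functional with $|\mathcal L(\mathbf w)|\le\|\mathcal L\|_{\mathbf V^*}\|\mathbf w\|_{\mathbf V}$ for any $\mathbf w\in\mathbf V$. Then for every $\mathbf f\in\mathbf V^*$, every $\boldsymbol r\in U\times U$ and every $\mathbf s\in\mathbb N^2$, $$|\mathcal L(\mathbf u(\cdot,\boldsymbol r))-\mathcal L(\mathbf u_{\mathbf s}(\cdot,\boldsymbol r^{\mathbf s}))|\le C\,\widetilde C\,\|\mathbf f\|_{\mathbf V^*}\|\mathcal L\|_{\mathbf V^*},$$ where $C$ depends on $\Omega$,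 $\mu$ and $\widehat\lambda$, and $$\widetilde C=\sum_{j\ge s_1+1}\|\psi_j\|_{L^\infty(\Omega)}+\sum_{j\ge s_2+1}\|\phi_j\|_{L^\infty(\Omega)}.$$ Moreover, if $\sum_{j\ge s_1+1}\|\psi_j\|_{L^\infty(\Omega)}\le C_p\,s_1^{1-1/p}$ and $\sum_{j\ge s_2+1}\|\phi_j\|_{L^\infty(\Omega)}\le C_q\,s_2^{1-1/q}$ for some $0<p,q<1$, then $\widetilde C\le C_{p,q}\big(s_1^{1-1/p}+s_2^{1-1/q}\big)$. A similar bound holds if instead $\|\psi_j\|_{L^\infty(\Omega)}$ and $\|\phi_j\|_{L^\infty(\Omega)}$ are nonincreasing in $j\ge 1$ and $\sum_{j\ge1}\|\psi_j\|^p_{L^\infty(\Omega)}<\infty$, $\sum_{j\ge1}\|\phi_j\|^q_{L^\infty(\Omega)}<\infty$ for some $0<p,q<1$.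
   Context: $\Omega\subset\mathbb R^2$ is a bounded domain with polygonal boundary. $U=(-\tfrac12,\tfrac12)^{\mathbb N}$ and $\boldsymbol y=(y_j)_{j\ge1},\boldsymbol z=(z_j)_{j\ge1}\in U$. The Lamé parameters are $\mu(\boldsymbol x,\boldsymbol y)=\mu_0(\boldsymbol x)+\sum_{j\ge1}y_j\psi_j(\boldsymbol x)$ and $\lambda(\boldsymbol x,\boldsymbol z)=\Lambda\widehat\lambda(\boldsymbol x,\boldsymbol z)=\Lambda\big(\widehat\lambda_0(\boldsymbol x)+\sum_{j\ge1}z_j\phi_j(\boldsymbol x)\big)$ with a constant $1\le\Lambda<\infty$ and $\{\psi_j\},\{\phi_j\}$ orthogonal basis functions for $L^2(\Omega)$. Standing assumption: there are positive constants with $\mu_{\min}\le\mu\le\mu_{\max}$, $\widehat\lambda_{\min}\le\widehat\lambda\le\widehat\lambda_{\max}$ on $\Omega\times U$. Generic constants in the paper are sought to be independent of $\Lambda$; dependence is only on the quantities listed. $\mathbf V=[H^1_0(\Omega)]^2$ with the $H^1$ norm $\|\cdot\|_{\mathbf V}$; $\mathbf V^*$ is its dual with respect to the $[L^2(\Omega)]^2$ inner product. $\boldsymbol\varepsilon(\mathbf v)=\frac12(\nabla\mathbf v+(\nabla\mathbf v)^T)$, the colon is the inner product of tensors, differential operators act in $\boldsymbol x$, $\ell(\mathbf v)=\int_\Omega\mathbf f\cdot\mathbf v\,d\boldsymbol x$ (duality pairing), and for $\boldsymbol r=(\boldsymbol y,\boldsymbol z)$ $$\mathcal B(\boldsymbol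 r;\mathbf u,\mathbf v)=\int_\Omega\big[2\mu(\cdot,\boldsymbol y)\,\boldsymbol\varepsilon(\mathbf u):\boldsymbol\varepsilon(\mathbf v)+\lambda(\cdot,\boldsymbol z)\,(\nabla\cdot\mathbf u)(\nabla\cdot\mathbf v)\big]\,d\boldsymbol x .$$ Truncation: $\boldsymbol r^{\mathbf s}=(\boldsymbol y^{s_1},\boldsymbol z^{s_2})$ with $\boldsymbol y^{s_1}=(y_1,\dots,y_{s_1},0,0,\dots)$ and $\boldsymbol z^{s_2}=(z_1,\dots,z_{s_2},0,0,\dots)$. *)

(* Defs.v *)
From HB Require Import structures.
From mathcomp Require Import all_boot all_order all_algebra.
From mathcomp Require Import all_classical all_reals all_analysis.
Set Implicit Arguments.
Unset Strict Implicit.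
Unset Printing Implicit Defensive.
Import Order.TTheory GRing.Theory Num.Theory.
Import numFieldNormedType.Exports.
Local Open Scope classical_set_scope.
Local Open Scope ring_scope.

(* Two-dimensional Lebesgue measure. *)
Notation leb2 R := (@lebesgue_measure R \x @lebesgue_measure R)%E.

(* ---- Polygonal domains ---- *)

Definition seg2 (R : realType) (a b : R * R) : set (R * R) :=
  [set x | exists2 t : R, 0 <= t <= 1 & x = (1 - t) *: a + t *: b].

(* A nonempty bounded connected open set whose topological boundary consists of
   finitely many nondegenerate closed segments. *)
Definition polygonal_domain (R : realType) (Omega : set (R * R)) : Prop :=
  [/\ Omega !=set0, open Omega, connected Omega, bounded_set Omega &
      exists s : seq ((R * R) * (R * R)),
        all (fun e => e.1 != e.2) s /\
        closure Omega `\` interior Omega =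
          [set x | exists2 e, e \in s & seg2 e.1 e.2 x]].

(* ---- Lebesgue spaces on Omega ---- *)

(* Functions are defined on the whole plane; only their restriction to Omega
   (extended by zero) is ever used. *)
Definition norm_Lp (R : realType) (Omega : set (R * R)) (p : \bar R)
    (f : R * R -> R) : \bar R :=
  Lnorm (leb2 R) p (EFin \o (f \_ Omega)).

Definition in_Lp (R : realType) (Omega : set (R * R)) (p : \bar R)
    (f : R * R -> R) : Prop :=
  (f \_ Omega) \in Lfun (leb2 R) p.

(* A sequence is an orthogonal basis of L^2(Omega): nonzero, pairwise
   orthogonal, with dense linear span. *)
Definition orthogonal_basis_L2 (R : realType) (Omega : set (R * R))
    (psi : nat -> R * R -> R) : Prop :=
  [/\ forall j, in_Lp Omega 2%:E (psi j),
      forall j, norm_Lp Omega 2%:E (psi j) != 0%E,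
      forall i j, i != j -> \int[leb2 R]_(x in Omega) (psi i x * psi j x) = 0 &
      forall g, in_Lp Omega 2%:E g -> forall e : R, 0 < e ->
        exists n (c : nat -> R),
          (norm_Lp Omega 2%:E (fun x => (g x - \sum_(j < n) c j * psi j x)%R)
             < e%:E)%E].

(* ---- Smooth test functions and Sobolev spaces ---- *)

Definition basis2 (R : realType) (j : 'I_2) : R * R :=
  if j == ord0 then (1, 0) else (0, 1).

Definition partial2 (R : realType) (j : 'I_2) (f : R * R -> R) : R * R -> R :=
  fun x => 'D_(basis2 R j) f x.

(* C^oo: all iterated partial derivatives exist and are continuous. *)
Definition smooth2 (R : realType) (f : R * R -> R) : Prop :=
  forall s : seq 'I_2, let g := foldr (@partial2 R) f s in
    continuous g /\ forall x j, derivable g x (basis2 R j).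

Definition test_fun (R : realType) (Omega : set (R * R)) (f : R * R -> R) :
    Prop :=
  smooth2 f /\
  exists K, [/\ compact K, K `<=` Omega & forall x, ~ K x -> f x = 0].

(* A vector-valued Sobolev function is carried together with its weak gradient
   (the Jacobian matrix, entry (i, j) being the j-th derivative of the i-th
   component), as a pair (w, Dw); the last condition in [in_H1] determines Dw
   from w almost everywhere in Omega.  The module operations are
   the pointwise ones of pairs of functions. *)
Definition vfield (R : realType) : Type :=
  ((R * R -> 'cV[R]_2) * (R * R -> 'M[R]_2))%type.

Definition value (R : realType) (w : vfield R) : R * R -> 'cV[R]_2 := w.1.
Definition grad (R : realType) (w : vfield R) : R * R -> 'M[R]_2 := w.2.

(* Inner product of tensors. *)
Definition tdot (R : realType) m n (A B : 'M[R]_(m, n)) : R :=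
  \sum_i \sum_j A i j * B i j.

Definition in_H1 (R : realType) (Omega : set (R * R)) (w : vfield R) : Prop :=
  [/\ forall i, in_Lp Omega 2%:E (fun x => value w x i ord0),
      forall i j, in_Lp Omega 2%:E (fun x => grad w x i j) &
      forall f, test_fun Omega f -> forall i j,
        \int[leb2 R]_(x in Omega) (value w x i ord0 * partial2 j f x) =
        - \int[leb2 R]_(x in Omega) (grad w x i j * f x)].

Definition norm_V (R : realType) (Omega : set (R * R)) (w : vfield R) : R :=
  Num.sqrt (\int[leb2 R]_(x in Omega)
    (tdot (value w x) (value w x) + tdot (grad w x) (grad w x))).

Definition of_smooth (R : realType) (v : R * R -> 'cV[R]_2) : vfield R :=
  (v, fun x => \matrix_(i, j) partial2 j (fun t => v t i ord0) x).

(* V = [H^1_0(Omega)]^2: the closure of the test functions in [H^1(Omega)]^2. *)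
Definition in_V (R : realType) (Omega : set (R * R)) (w : vfield R) : Prop :=
  in_H1 Omega w /\
  forall e : R, 0 < e -> exists v : R * R -> 'cV[R]_2,
    (forall i, test_fun Omega (fun x => v x i ord0)) /\
    norm_V Omega (w - of_smooth v) < e.

(* The dual V^*: bounded linear functionals on V; values outside V are
   irrelevant. *)
Definition in_dual (R : realType) (Omega : set (R * R)) (l : vfield R -> R) :
    Prop :=
  (forall (a : R) u v, in_V Omega u -> in_V Omega v ->
     l (a *: u + v) = a * l u + l v) /\
  exists M : R, forall w, in_V Omega w -> `|l w| <= M * norm_V Omega w.

Definition norm_dual (R : realType) (Omega : set (R * R))
    (l : vfield R -> R) : R :=
  sup [set `|l w| | w in [set w | in_V Omega w /\ norm_V Omega w <= 1]].

(* ---- Parametric elasticity ---- *)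

(* Parameter sequences (y_1, y_2, ...) and expansion functions are indexed from
   0: [y j] stands for y_{j+1} and [psi j] for psi_{j+1}. *)
Definition in_U (R : realType) (y : nat -> R) : Prop :=
  forall j, - 2^-1 < y j < 2^-1.

Definition truncate (R : realType) (s : nat) (y : nat -> R) : nat -> R :=
  fun j => if (j < s)%N then y j else 0.

Definition expansion (R : realType) (a0 : R * R -> R)
    (psi : nat -> R * R -> R) (y : nat -> R) (x : R * R) : R :=
  a0 x + limn (series (fun j => y j * psi j x)).

(* lambda = Lam * lambda^, the expansion being that of lambda^. *)
Definition lame_lambda (R : realType) (Lam : R) (lhat0 : R * R -> R)
    (phi : nat -> R * R -> R) (z : nat -> R) (x : R * R) : R :=
  Lam * expansion lhat0 phi z x.

(* Positive lower and upper bounds on Omega x U. *)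
Definition bounded_coef (R : realType) (Omega : set (R * R))
    (a : (nat -> R) -> R * R -> R) : Prop :=
  exists amin amax : R, [/\ 0 < amin, 0 < amax &
    forall y, in_U y ->
      {ae leb2 R, forall x, Omega x -> amin <= a y x <= amax}].

Definition strain (R : realType) (w : vfield R) (x : R * R) : 'M[R]_2 :=
  2^-1 *: (grad w x + (grad w x)^T).

Definition divergence (R : realType) (w : vfield R) (x : R * R) : R :=
  \tr (grad w x).

Definition bform (R : realType) (Omega : set (R * R)) (mu lam : R * R -> R)
    (u v : vfield R) : R :=
  \int[leb2 R]_(x in Omega)
    (2 * mu x * tdot (strain u x) (strain v x)
     + lam x * (divergence u x * divergence v x)).

Definition is_solution (R : realType) (Omega : set (R * R))
    (mu lam : R * R -> R) (l : vfield R -> R) (u : vfield R) : Prop :=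
  in_V Omega u /\
  forall v, in_V Omega v -> bform Omega mu lam u v = l v.

(* sum_{j >= s+1} |psi_j|_{L^oo}, in the shifted indexing. *)
Definition tail_Linf (R : realType) (Omega : set (R * R))
    (psi : nat -> R * R -> R) (s : nat) : \bar R :=
  (\sum_(s <= j <oo) norm_Lp Omega +oo (psi j))%E.

Definition Ctilde (R : realType) (Omega : set (R * R))
    (psi phi : nat -> R * R -> R) (s1 s2 : nat) : \bar R :=
  (tail_Linf Omega psi s1 + tail_Linf Omega phi s2)%E.

Definition rate (R : realType) (p : R) (s : nat) : R := s%:R `^ (1 - p^-1).

(* Main.v *)
Require Import Defs.
From mathcomp Require Import all_boot all_order all_algebra.
From mathcomp Require Import all_classical all_reals all_analysis.
From mathcomp Require Import measurable_realfun ess_sup_inf.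
From mathcomp Require Import ring lra.
Set Implicit Arguments.
Unset Strict Implicit.
Unset Printing Implicit Defensive.
Import Order.TTheory GRing.Theory Num.Theory.
Import numFieldNormedType.Exports.
Local Open Scope classical_set_scope.
Local Open Scope ring_scope.

(** Let [w = u - us] be the error.  Both solutions answer to the same load, so
    the form with the full coefficients satisfies the residual identity
    [B (w, w) = Bs (us, w) - B (us, w)], where [Bs] has the truncated
    coefficients: the error is driven by the perturbation of the coefficients
    tested against [us] and [w].

    What makes the constant uniform in [Lam] is the choice of energy
    quantities: the L2 norm of the strain and [sqrt Lam] times the L2 norm of
    the divergence.  The second Lame coefficient and its perturbation carry the
    same factor [Lam], and in these quantities it is absorbed symmetrically:
    coercivity ([bform_ge]) and the bound on the perturbed form ([bform_le])
    have constants free of [Lam].  The energy estimate for [us] bounds both of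
    its quantities by the norm of the load; inserted in the residual identity,
    this bounds the strain of [w] by the size of the perturbation times that
    norm ([perturbation_estimate]).  Almost everywhere the perturbation is at
    most the tail of the series of essential suprema, because the parameters
    are at most 1 in absolute value ([truncated_expansion_bound]).

    To return from the strain to the norm of V one needs the Korn and Poincare
    inequalities on V ([norm_V_sqr_le_strain]).  Both follow from the
    definition of the weak gradient by choosing its test function well.  Taking
    partial derivatives of a test function, and their symmetry
    ([partial2_swap]), gives the identity of cross derivatives behind Korn;
    taking the first coordinate times a test function gives Poincare, the
    domain being bounded.  In each case the resulting identity is linear and
    continuous in the test function, hence extends to V by density
    ([test_identity_extends]).

    The algebraic decay of the tails for nonincreasing p-summable sequences is
    Stechkin's inequality ([nonincreasing_tail_rate]). *)

(** * Square-integrable functions on a measurable set *)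

Section SquareIntegrable.
Context d (T : measurableType d) (R : realType).
Variables (mu : {measure set T -> \bar R}) (D : set T).
Hypothesis mD : measurable D.
Implicit Types (f g c : T -> R) (M : R).

(** Extending by zero makes this convertible to membership in [in_Lp], and lets
    the closure properties of [Lfun] be used. *)
Definition L2on f := (f \_ D) \in Lfun mu 2%:E.

Definition ip f g : R := \int[mu]_(x in D) (f x * g x).

Lemma L2on_measurable f : L2on f -> measurable_fun D f.
Proof.
rewrite /L2on inE => /andP[]; rewrite inE /= => mf _.
exact/(measurable_restrictT _ mD).
Qed.

Lemma L2on_linear (a : R) f g : L2on f -> L2on g ->
  L2on (fun x => a * f x + g x).
Proof.
move=> Lf Lg.
rewrite /L2on (_ : _ \_ D = a *: (f \_ D) + (g \_ D)); last first.
  apply/funext => x; rewrite /patch /= !fctE /GRing.scale /= /patch.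
  by case: ifP => // _; rewrite mulr0 addr0.
have p1 : (1 <= 2%:E :> \bar R)%E by rewrite lee_fin ler1n.
have [_ clo] := Lfun_submod_closed mu p1; exact: clo.
Qed.

Lemma L2on_ext f g : {in D, f =1 g} -> L2on f -> L2on g.
Proof.
move=> fg; rewrite /L2on => Lf; rewrite (_ : g \_ D = f \_ D) //.
by apply/funext => x; rewrite /patch; case: ifPn => // xD; rewrite fg.
Qed.

Lemma L2on_mul_integrable f g : L2on f -> L2on g ->
  mu.-integrable D (EFin \o (fun x => f x * g x)).
Proof.
move=> Lf Lg; apply/(integrable_mkcond _ mD).
have /Lfun1_integrable := Lfun2_mul_Lfun1 Lf Lg.
apply: eq_integrable => // x _ /=; rewrite /patch /=.
by case: ifP => //; rewrite mulr0.
Qed.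

Lemma L2on_of_sqr_integrable f : measurable_fun D f ->
  mu.-integrable D (EFin \o (fun x => f x * f x)) -> L2on f.
Proof.
move=> mf /(integrable_mkcond _ mD)/integrableP[_ If].
rewrite /L2on inE; apply/andP; split; rewrite inE /=.
  exact/(measurable_restrictT _ mD).
rewrite /finite_norm unlock; apply: poweR_lty.
rewrite (le_lt_trans _ If)// le_eqVlt; apply/orP; left; apply/eqP.
apply: eq_integral => x _ /=; rewrite /patch; case: ifP => _ /=.
  by rewrite powR_mulrn// real_normK ?num_real// expr2 ger0_norm // -expr2 sqr_ge0.
by rewrite normr0 powR_mulrn// expr0n.
Qed.

Lemma L2on_dominated f g : measurable_fun D f -> L2on g ->
  (forall x, D x -> `|f x| <= `|g x|) -> L2on f.
Proof.
move=> mf Lg fg; apply: L2on_of_sqr_integrable => //.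
apply: (le_integrable mD _ _ (L2on_mul_integrable Lg Lg)).
  by apply/measurable_EFinP; exact: measurable_funM.
by move=> x Dx /=; rewrite lee_fin !normrM ler_pM ?fg.
Qed.

Lemma L2on_norm f : L2on f -> L2on (fun x => `|f x|).
Proof.
move=> Lf; apply: (L2on_dominated _ Lf) => [|x _]; last by rewrite normr_id.
exact: measurableT_comp (L2on_measurable Lf).
Qed.

Lemma L2on0 : L2on (fun=> 0).
Proof.
apply: L2on_of_sqr_integrable; first exact: measurable_cst.
by under eq_fun do rewrite mulr0; exact: integrable0.
Qed.

Lemma L2onZ a f : L2on f -> L2on (fun x => a * f x).
Proof.
by move=> Lf; apply: L2on_ext (L2on_linear a Lf L2on0) => x _; rewrite addr0.
Qed.

Lemma L2onD f g : L2on f -> L2on g -> L2on (fun x => f x + g x).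
Proof.
by move=> Lf Lg; apply: L2on_ext (L2on_linear 1 Lf Lg) => x _; rewrite mul1r.
Qed.

Lemma ipC f g : ip f g = ip g f.
Proof. by apply: eq_Rintegral => x _; rewrite mulrC. Qed.

Lemma ip_ge0 f : 0 <= ip f f.
Proof. by apply: Rintegral_ge0 => x _; rewrite -expr2 sqr_ge0. Qed.

Lemma ip_linear a f1 f2 g : L2on f1 -> L2on f2 -> L2on g ->
  ip (fun x => a * f1 x + f2 x) g = a * ip f1 g + ip f2 g.
Proof.
move=> L1 L2 Lg; rewrite /ip.
rewrite -RintegralZl//; last exact: L2on_mul_integrable.
rewrite -RintegralD//; last exact: L2on_mul_integrable.
  by apply: eq_Rintegral => x _; rewrite mulrDl mulrA.
under eq_fun do rewrite mulrA.
by apply: L2on_mul_integrable => //; exact: L2onZ.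
Qed.

Lemma ip0l g : ip (fun=> 0) g = 0.
Proof.
by rewrite /ip; under eq_Rintegral do rewrite mul0r; rewrite Rintegral_cst// mul0r.
Qed.

Lemma ipZl a f g : L2on f -> L2on g -> ip (fun x => a * f x) g = a * ip f g.
Proof.
move=> Lf Lg; rewrite -RintegralZl//; last exact: L2on_mul_integrable.
by apply: eq_Rintegral => x _; rewrite mulrA.
Qed.

Lemma ipZr a f g : L2on f -> L2on g -> ip f (fun x => a * g x) = a * ip f g.
Proof. by move=> Lf Lg; rewrite ipC ipZl// ipC. Qed.

Lemma ip_sqr_linear a f g : L2on f -> L2on g ->
  ip (fun x => a * f x + g x) (fun x => a * f x + g x) =
  a ^+ 2 * ip f f + 2 * a * ip f g + ip g g.
Proof.
move=> Lf Lg; have Lfg := L2on_linear a Lf Lg.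
rewrite ip_linear// (ipC f) (ipC g) !ip_linear// (ipC g f); ring.
Qed.

(** The square of the norm of [a f + g] is a nonnegative quadratic polynomial in
    [a]; the discriminant argument needs a separate case when [f] has norm zero,
    where the polynomial is affine and so must be constant. *)
Lemma ip_cauchy_schwarz f g : L2on f -> L2on g ->
  `|ip f g| <= Num.sqrt (ip f f) * Num.sqrt (ip g g).
Proof.
move=> Lf Lg; rewrite -sqrtrM ?ip_ge0// -sqrtr_sqr ler_wsqrtr//.
have [C0|Cn0] := eqVneq (ip f f) 0.
  have H a : 0 <= 2 * a * ip f g + ip g g.
    by have := ip_ge0 (fun x => a * f x + g x); rewrite ip_sqr_linear// C0 mulr0 add0r.
  rewrite C0 mul0r le_eqVlt; apply/orP; left; rewrite sqrf_eq0.
  apply/negPn/negP => fg0.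
  (* for this value of [a] the affine polynomial is -1 *)
  have := H (- (ip g g + 1) / (2 * ip f g)).
  rewrite (_ : 2 * _ * _ + _ = -1) ?oppr_ge0 ?ler10//; field.
  by [].
have C0 : 0 < ip f f by rewrite lt_def Cn0 ip_ge0.
have := ip_ge0 (fun x => (- ip f g / ip f f) * f x + g x).
(* the minimum of the polynomial *)
rewrite ip_sqr_linear// (_ : _ + _ = ip g g - ip f g ^+ 2 / ip f f).
  by rewrite subr_ge0 ler_pdivrMr// mulrC.
by field.
Qed.

Lemma integrable_Rsum (I : Type) (s : seq I) (F : I -> T -> R) :
  (forall i, mu.-integrable D (EFin \o F i)) ->
  mu.-integrable D (EFin \o (fun x => \sum_(i <- s) F i x)).
Proof.
move=> FI; elim: s => [|i s IH].
  by under eq_fun do rewrite big_nil; exact: integrable0.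
have := integrableD mD (FI i) IH; apply: eq_integrable => // x _ /=.
by rewrite big_cons EFinD.
Qed.

Lemma Rintegral_sum (I : Type) (s : seq I) (F : I -> T -> R) :
  (forall i, mu.-integrable D (EFin \o F i)) ->
  \int[mu]_(x in D) (\sum_(i <- s) F i x) =
  \sum_(i <- s) \int[mu]_(x in D) F i x.
Proof.
move=> FI; elim: s => [|i s IH].
  by rewrite big_nil; under eq_Rintegral do rewrite big_nil; rewrite Rintegral_cst// mul0r.
rewrite big_cons -IH -RintegralD//; last exact: integrable_Rsum.
by apply: eq_Rintegral => x _; rewrite big_cons.
Qed.

End SquareIntegrable.
Arguments ipC {d T R mu D} f g.

(** * Essentially bounded weights *)

Section AlmostEverywhereBounds.
Context d (T : measurableType d) (R : realType).
Variables (mu : {measure set T -> \bar R}) (D : set T).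
Hypothesis mD : measurable D.
Implicit Types (f g c : T -> R) (M : R).

Lemma ae_on_impl (P Q : T -> Prop) : (forall x, D x -> P x -> Q x) ->
  {ae mu, forall x, D x -> P x} -> {ae mu, forall x, D x -> Q x}.
Proof. by move=> PQ; apply: filterS => x Px Dx; exact: PQ (Px Dx). Qed.

Lemma ae_dominated_integrable (f g : T -> R) : measurable_fun D f ->
  mu.-integrable D (EFin \o g) ->
  {ae mu, forall x, D x -> `|f x| <= `|g x|} ->
  mu.-integrable D (EFin \o f).
Proof.
move=> mf /integrableP[mg ig] fg; apply/integrableP; split.
  exact/measurable_EFinP.
apply: le_lt_trans ig; apply: ae_ge0_le_integral => //.
- by apply: measurableT_comp => //; exact/measurable_EFinP.
- exact: measurableT_comp.
Qed.

Lemma ae_le_Rintegral (f g : T -> R) :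
  mu.-integrable D (EFin \o f) -> mu.-integrable D (EFin \o g) ->
  {ae mu, forall x, D x -> f x <= g x} ->
  \int[mu]_(x in D) f x <= \int[mu]_(x in D) g x.
Proof.
move=> fi gi fg; rewrite -subr_ge0 -RintegralB//.
have mf : measurable_fun D f by apply/measurable_EFinP/(measurable_int mu).
have mg : measurable_fun D g by apply/measurable_EFinP/(measurable_int mu).
(* [g - f] agrees almost everywhere with its positive part *)
rewrite (_ : Rintegral _ _ _ = \int[mu]_(x in D) Num.max (g x - f x) 0).
  by apply: Rintegral_ge0 => x _; rewrite le_max lexx orbT.
congr fine; apply: ae_eq_integral => //.
- by apply/measurable_EFinP; exact: measurable_funB.
- by apply/measurable_EFinP; apply: measurable_maxr => //; exact: measurable_funB.
- by apply: filterS fg => x + Dx => /(_ Dx) fgx; rewrite max_l // subr_ge0.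
Qed.

Definition ae_bounded_on M c :=
  measurable_fun D c /\ {ae mu, forall x, D x -> `|c x| <= M}.

Lemma ae_bounded_mul_integrable M c h : ae_bounded_on M c ->
  mu.-integrable D (EFin \o h) ->
  mu.-integrable D (EFin \o (fun x => c x * h x)).
Proof.
move=> [mc cM] hi.
have mh : measurable_fun D h by apply/measurable_EFinP/(measurable_int mu).
apply: (@ae_dominated_integrable _ (fun x => M * h x)).
- exact: measurable_funM.
- exact: (integrableZl mD M hi).
- apply: filterS cM => x + Dx => /(_ Dx) cM.
  by rewrite !normrM ler_wpM2r// (le_trans cM)// ler_norm.
Qed.

(** Hoelder's inequality with exponents infinity, 2 and 2. *)
Lemma weighted_ip_le M c f g : 0 <= M -> ae_bounded_on M c ->
  L2on mu D f -> L2on mu D g ->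
  `|\int[mu]_(x in D) (c x * (f x * g x))|
    <= M * (Num.sqrt (ip mu D f f) * Num.sqrt (ip mu D g g)).
Proof.
move=> M0 cb Lf Lg; have fg := L2on_mul_integrable mD Lf Lg.
have cfg := ae_bounded_mul_integrable cb fg.
have nfg := L2on_mul_integrable mD (L2on_norm mD Lf) (L2on_norm mD Lg).
have ip_norm h : ip mu D (fun x => `|h x|) (fun x => `|h x|) = ip mu D h h.
  by apply: eq_Rintegral => x _; rewrite -normrM ger0_norm// -expr2 sqr_ge0.
apply: le_trans (le_normr_Rintegral mD cfg) _.
apply: (@le_trans _ _ (M * ip mu D (fun x => `|f x|) (fun x => `|g x|))).
  rewrite -RintegralZl//; apply: ae_le_Rintegral.
  - have := integrable_norm cfg; exact.
  - exact: (integrableZl mD M nfg).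
  - have [_] := cb; apply: filterS => x + Dx => /(_ Dx) cM.
    by rewrite !normrM ler_wpM2r// mulr_ge0.
rewrite ler_wpM2l// (le_trans (ler_norm _))//.
have := ip_cauchy_schwarz mD (L2on_norm mD Lf) (L2on_norm mD Lg).
by rewrite !ip_norm.
Qed.

Lemma weighted_ip_ge M m c f : ae_bounded_on M c -> L2on mu D f ->
  {ae mu, forall x, D x -> m <= c x} ->
  m * ip mu D f f <= \int[mu]_(x in D) (c x * (f x * f x)).
Proof.
move=> cb Lf mc; have ff := L2on_mul_integrable mD Lf Lf.
rewrite -RintegralZl//; apply: ae_le_Rintegral.
- exact: (integrableZl mD m ff).
- exact: ae_bounded_mul_integrable cb ff.
- by apply: filterS mc => x + Dx => /(_ Dx) ?; rewrite ler_wpM2r// -expr2 sqr_ge0.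
Qed.

(** Where the sequence diverges, [limn] takes the default value [point], so the
    set of convergence must itself be shown measurable: it is where the lower and
    upper limits agree and are finite.  This is applied to the expansions of the
    coefficients, whose series is only known to converge almost everywhere. *)
Lemma measurable_limn (h : (T -> R)^nat) :
  (forall n, measurable_fun D (h n)) ->
  measurable_fun D (fun x => limn (h ^~ x)).
Proof.
move=> mh.
pose eh n x := (h n x)%:E.
have meh n : measurable_fun D (eh n) by apply/measurable_EFinP.
have ms : measurable_fun D (fun x => limn_esup (eh ^~ x)) by exact: measurable_fun_limn_esup.
have mi : measurable_fun D (fun x => limn_einf (eh ^~ x)).
  rewrite (_ : (fun _ => _) = fun x => (- limn_esup (fun n => - eh n x))%E).
    apply: measurableT_comp => //; apply: measurable_fun_limn_esup => n.
    exact: measurableT_comp.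
  by apply/funext => x; rewrite -[X in _ = (- X)%E]/(limn_esup (-%E \o eh ^~ x)) limn_esupN oppeK.
pose E := (D `&` [set x | limn_einf (eh ^~ x) = limn_esup (eh ^~ x)]) `&`
  (D `&` [set x | limn_esup (eh ^~ x) \is a fin_num]).
have mE : measurable E.
  by apply: measurableI; [exact: measurable_eqe|exact: emeasurable_fin_num].
have ED : E `&` D = E by apply/setIidPl => x [[]].
(* restriction to [E] also uses [point] as its default value *)
apply: (@measurable_fun_cvg _ _ _ _ (fun n => (h n) \_ E)) => [n|x Dx].
  apply/(measurable_restrict _ mE mD); rewrite setIC ED.
  by apply: measurable_funS (mh n) => // x [[]].
have [xE|xE] := boolP (x \in E).
  rewrite (_ : (fun _ => _) = h ^~ x); last by apply/funext => n; rewrite /patch xE.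
  move: xE; rewrite inE => -[[_ /= eq_lim] [_ /= fin_lim]].
  suff ch : eh ^~ x @ \oo --> (fine (limn_esup (eh ^~ x)))%:E.
    have /fine_cvgP[_ ch'] := ch.
    have : cvgn (h ^~ x) by apply/cvg_ex; eexists; exact: ch'.
    exact.
  rewrite fineK//.
  apply: (@squeeze_cvge _ _ _ _ (einfs (eh ^~ x)) _ (esups (eh ^~ x))).
  - by apply: nearW => n; apply/andP; split;
      [apply: ereal_inf_lbound|apply: ereal_sup_ubound]; exists n => /=.
  - by rewrite -eq_lim limn_einf_lim; exact: is_cvg_einfs.
  - by rewrite limn_esup_lim; exact: is_cvg_esups.
rewrite (_ : (fun _ => _) = cst point); last first.
  by apply/funext => n; rewrite /patch (negbTE xE).
rewrite dvgP; first exact: cvg_cst.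
move=> /cvg_ex[l hl]; move/negP: xE; apply; rewrite inE.
have /cvg_limn_einf_sup[il sl] : eh ^~ x @ \oo --> l%:E by apply/fine_cvgP; split => //; exact: nearW.
by split; split=> //=; rewrite ?il ?sl.
Qed.

End AlmostEverywhereBounds.

(** * Lebesgue measure of the plane *)

Section Plane.
Variable R : realType.
Implicit Types (O : set (R * R)) (f g : R * R -> R).

Local Notation plane := (measurableTypeR R * measurableTypeR R)%type.

(** The sigma-algebra is the product one, so an open set is written as the union
    of the countably many squares with rational center and half-side that it contains. *)
Lemma open_measurable2 O : open O -> measurable (O : set plane).
Proof.
move=> oO.
pose B (r p q : rat) : set (R * R) := ball (ratr p : R) (ratr r) `*` ball (ratr q : R) (ratr r).
pose F r p q := if pselect (B r p q `<=` O) then B r p q else set0.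
rewrite (_ : O = \bigcup_r \bigcup_p \bigcup_q F r p q).
  do 3 (apply: bigcupT_measurable_rat => ?); rewrite /F.
  case: pselect => ? /=; last exact: measurable0.
  by apply: measurableX; exact: measurable_ball.
apply/seteqP; split => [[a b] Oab|x [r _ [p _ [q _]]]]; last first.
  by rewrite /F; case: pselect => [sub|nsub] /= xB; [exact: sub|].
have /nbhs_ballP[e /= e0 eO] : nbhs (a, b) O by apply: open_nbhs_nbhs.
have [r] : exists r : rat, (ratr r : R) \in `]0, e / 2[.
  by apply: rat_in_itvoo; rewrite divr_gt0.
rewrite in_itv/= => /andP[r0 re].
have near_rat (c : R) : exists p : rat, `|ratr p - c| < ratr r.
  have [p] : exists p : rat, (ratr p : R) \in `](c - ratr r), (c + ratr r)[.
    by apply: rat_in_itvoo; rewrite ltrBlDr -addrA ltrDl addr_gt0.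
  by rewrite in_itv/= => pc; exists p; rewrite ltr_distl.
have [p pa] := near_rat a; have [q qb] := near_rat b.
exists r => //; exists p => //; exists q => //; rewrite /F; case: pselect => [?|[]].
  by split.
move=> [x y] [/= xp yq]; apply: eO; split=> /=.
- rewrite /ball /=; rewrite /ball /= in xp.
  rewrite (_ : a - x = (ratr p - x) - (ratr p - a)); last by ring.
  rewrite (le_lt_trans (ler_normB _ _))// [e]splitr ltrD//; exact: lt_trans re.
- rewrite /ball /=; rewrite /ball /= in yq.
  rewrite (_ : b - y = (ratr q - y) - (ratr q - b)); last by ring.
  rewrite (le_lt_trans (ler_normB _ _))// [e]splitr ltrD//; exact: lt_trans re.
Qed.

Lemma continuous_measurable2 f : continuous f ->
  measurable_fun setT (f : plane -> R).
Proof.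
move=> /continuousP cf; apply: (measurability _ (RGenOpens.measurableE R)).
move=> _ [_ [a [b ->] <-]]; rewrite setTI; apply: open_measurable2.
exact/cf/interval_open.
Qed.

Lemma bounded_leb2_lty O : measurable (O : set plane) -> bounded_set O -> (leb2 R O < +oo)%E.
Proof.
move=> mO [M [_ bM]]; set K := `|M| + 1.
have OK : O `<=` `[-K, K]%classic `*` `[-K, K]%classic.
  move=> x Ox; have : `|x| <= K.
    by apply: bM => //; rewrite /K (le_lt_trans (ler_norm M))// ltrDl.
  rewrite prod_normE ge_max => /andP[x1 x2].
  by split; rewrite /= in_itv /= -ler_norml.
apply: (@le_lt_trans _ _ (leb2 R (`[-K, K]%classic `*` `[-K, K]%classic))).
  apply: le_measure; rewrite ?inE//; exact: measurableX.
rewrite product_measure1E//=.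
by rewrite !lebesgue_measure_itv /=; case: ifP => //; rewrite -?EFinB -?EFinM ?mule0 ltry.
Qed.

End Plane.

(** * Smooth functions of two variables *)

Section SmoothFunctions.
Variable R : realType.
Implicit Types (f g : R * R -> R) (i j : 'I_2).
Local Notation e := (basis2 R).

Lemma smooth2_continuous f : smooth2 f -> continuous f.
Proof. by move=> /(_ [::]) []. Qed.

Lemma smooth2_derivable f x j : smooth2 f -> derivable f x (e j).
Proof. by move=> /(_ [::]) [_]; apply. Qed.

Arguments smooth2_derivable [f] x j _.

Lemma smooth2_partial f j : smooth2 f -> smooth2 (partial2 j f).
Proof. by move=> sf s; have := sf (rcons s j); rewrite foldr_rcons. Qed.

Arguments smooth2_partial [f] j _.

(** Coinduction for smoothness: exhibiting a class of functions stable under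
    partial derivatives avoids closed formulas for iterated derivatives. *)
Lemma smooth2_coind (P : (R * R -> R) -> Prop) :
  (forall f, P f -> [/\ continuous f, forall x j, derivable f x (e j) &
     forall j, P (partial2 j f)]) ->
  forall f, P f -> smooth2 f.
Proof.
move=> HP f Pf s g.
suff Pg : P g by have [] := HP _ Pg.
rewrite /g; elim: s {g} => [//|j s IH] /=.
by have [_ _] := HP _ IH; apply.
Qed.

Lemma partial2_linear (a : R) f g j : smooth2 f -> smooth2 g ->
  partial2 j (fun x => a * f x + g x) =
  (fun x => a * partial2 j f x + partial2 j g x).
Proof.
move=> sf sg; apply/funext => x; rewrite /partial2.
rewrite -[fun x => a * f x + g x]/((a \*: f) + g).
have df := smooth2_derivable x j sf.
by rewrite (deriveD (derivableZ df) (smooth2_derivable x j sg)) (deriveZ _ df).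
Qed.

Lemma smooth2_linear (a : R) f g : smooth2 f -> smooth2 g ->
  smooth2 (fun x => a * f x + g x).
Proof.
move=> sf sg.
pose P h := exists f' g', [/\ smooth2 f', smooth2 g' & h = fun x => a * f' x + g' x].
apply: (@smooth2_coind P); last by exists f, g.
move=> _ [f' [g' [sf' sg' ->]]]; split.
- move=> x; apply: cvgD; last exact: smooth2_continuous.
  by apply: cvgM; [exact: cvg_cst|exact: smooth2_continuous].
- move=> x j; rewrite -[fun x => a * f' x + g' x]/((a \*: f') + g').
  apply: derivableD; last exact: smooth2_derivable.
  by apply: derivableZ; exact: smooth2_derivable.
- move=> j; exists (partial2 j f'), (partial2 j g'); split.
  + exact: smooth2_partial.
  + exact: smooth2_partial.
  + exact: partial2_linear.
Qed.

Lemma is_derive_fst (x v : R * R) : is_derive x v fst v.1.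
Proof.
have H : (fun h : R => h^-1 *: ((fst \o shift x) (h *: v) - x.1)) @ 0^' --> v.1.
  apply: cvg_near_cst; near=> h.
  rewrite /= addrK /GRing.scale /= mulrA mulVf ?mul1r//.
  near: h; exact: nbhs_dnbhs_neq.
by apply: DeriveDef; [apply: cvgP H|apply: cvg_lim H].
Unshelve. all: by end_near. Qed.

Lemma derivable_fst_mul f g x j : smooth2 f -> smooth2 g ->
  is_derive x (e j) (fun x => x.1 * f x + g x)
   (x.1 * partial2 j f x + ((e j).1 * f x + partial2 j g x)).
Proof.
move=> sf sg.
have dx := is_derive_fst x (e j).
have df := derivableP (smooth2_derivable x j sf).
have dg := derivableP (smooth2_derivable x j sg).
rewrite -[fun x => x.1 * f x + g x]/((fst * f) + g).
apply: is_derive_eq; rewrite /partial2 /GRing.scale /=; ring.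
Qed.

(** The summand [g] makes the class of these functions stable under partial
    derivatives, since differentiating the first coordinate leaves a multiple of [f]. *)
Lemma smooth2_fst_mul f g : smooth2 f -> smooth2 g ->
  smooth2 (fun x => x.1 * f x + g x).
Proof.
move=> sf sg.
pose P h := exists f' g', [/\ smooth2 f', smooth2 g' & h = fun x => x.1 * f' x + g' x].
apply: (@smooth2_coind P); last by exists f, g.
move=> _ [f' [g' [sf' sg' ->]]]; split.
- move=> x; apply: cvgD; last exact: smooth2_continuous.
  by apply: cvgM; [exact: cvg_fst|exact: smooth2_continuous].
- by move=> x j; have [] := derivable_fst_mul x j sf' sg'.
- move=> j; exists (partial2 j f'), (fun x => (e j).1 * f' x + partial2 j g' x).
  split; [exact: smooth2_partial| |].
    exact: smooth2_linear _ sf' (smooth2_partial j sg').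
  by apply/funext => x; have [_] := derivable_fst_mul x j sf' sg'.
Qed.

Lemma is_derive_line f (x v : R * R) (s : R) : derivable f (x + s *: v) v ->
  is_derive s 1 (fun t => f (x + t *: v)) ('D_v f (x + s *: v)).
Proof.
move=> df.
have E : (fun h : R => h^-1 *: (((fun t => f (x + t *: v)) \o shift s) (h *: 1)
      - f (x + s *: v))) =
  (fun h : R => h^-1 *: ((f \o shift (x + s *: v)) (h *: v) - f (x + s *: v))).
  apply/funext => h /=; congr (_ *: (f _ - _)).
  by rewrite /GRing.scale /= mulr1 -/(_ *: _) scalerDl addrC addrA addrAC addrC.
by apply: DeriveDef; rewrite /derivable /derive E.
Qed.

Lemma mvt_line f (x v : R * R) (h : R) : 0 <= h ->
  (forall y, derivable f y v) ->
  exists2 s, 0 <= s <= h & f (x + h *: v) - f x = h * 'D_v f (x + s *: v).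
Proof.
move=> h0 df.
have dl s := is_derive_line (df (x + s *: v)).
have cl : {within `[0, h], continuous (fun t => f (x + t *: v))}.
  apply: continuous_subspaceT => s.
  by apply: differentiable_continuous; apply/derivable1_diffP; have [] := dl s.
have [s] := MVT_segment h0 (fun s _ => dl s) cl.
rewrite in_itv /= subr0 scale0r addr0 => s0h ->.
by exists s => //; rewrite mulrC.
Qed.

(** The mean value theorem applied twice to the second difference over a square,
    first along [e i] to the increment in direction [e j], then along [e j] to the
    derivative so obtained. *)
Lemma mixed_difference f (x : R * R) i j (h : R) : 0 <= h -> smooth2 f ->
  exists s t, [/\ 0 <= s <= h, 0 <= t <= h &
   f (x + h *: e i + h *: e j) - f (x + h *: e i) - f (x + h *: e j) + f x =
   h ^+ 2 * partial2 j (partial2 i f) (x + s *: e i + t *: e j)].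
Proof.
move=> h0 sf; pose g y := f (y + h *: e j) - f y.
have dsh y : is_derive y (e i) (fun z => f (z + h *: e j)) (partial2 i f (y + h *: e j)).
  have := smooth2_derivable (y + h *: e j) i sf => df.
  have E : (fun k : R => k^-1 *: (((fun z => f (z + h *: e j)) \o shift y) (k *: e i)
      - f (y + h *: e j))) =
    (fun k : R => k^-1 *: ((f \o shift (y + h *: e j)) (k *: e i) - f (y + h *: e j))).
    by apply/funext => k /=; rewrite addrA.
  by apply: DeriveDef; rewrite /partial2 /derivable /derive E.
have dg y : is_derive y (e i) g (partial2 i f (y + h *: e j) - partial2 i f y).
  have d1 := dsh y; have d2 := derivableP (smooth2_derivable y i sf).
  rewrite -[g]/((fun z => f (z + h *: e j)) - f).
  exact: is_derive_eq.
have [s sh Es] := @mvt_line g x (e i) h h0 (fun y => @ex_derive _ _ _ _ _ _ _ (dg y)).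
have [t th Et] := @mvt_line (partial2 i f) (x + s *: e i) (e j) h h0
   (fun y => smooth2_derivable y j (smooth2_partial i sf)).
exists s, t; split=> //.
have Dg := @derive_val _ _ _ _ _ _ _ (dg (x + s *: e i)).
rewrite Dg Et mulrA -expr2 in Es.
by rewrite -[RHS]Es /g; ring.
Qed.

Lemma basis2_norm_le1 i : `|e i| <= 1.
Proof.
by rewrite /basis2; case: ifP => _; rewrite prod_normE /= normr0 normr1 ge_max lexx ler01.
Qed.

(** Schwarz's theorem: both mixed derivatives take, at points arbitrarily close to
    [x], the value of the same second difference quotient. *)
Lemma partial2_swap f i j : smooth2 f ->
  partial2 i (partial2 j f) = partial2 j (partial2 i f).
Proof.
move=> sf; apply/funext => x.
have sA := smooth2_continuous (smooth2_partial i (smooth2_partial j sf)).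
have sB := smooth2_continuous (smooth2_partial j (smooth2_partial i sf)).
apply/eqP; rewrite -subr_eq0 -normr_le0; apply/ler_addgt0Pl => eps eps0; rewrite addr0.
have e2 : 0 < eps / 2 by rewrite divr_gt0.
have /cvgrPdist_lt/(_ _ e2)/nbhs_ballP[dA /= dA0 HA] := sA x.
have /cvgrPdist_lt/(_ _ e2)/nbhs_ballP[dB /= dB0 HB] := sB x.
have [h h0 hm] : exists2 h, 0 < h & h + h < Num.min dA dB.
  have m0 : 0 < Num.min dA dB by rewrite lt_min dA0.
  exists (Num.min dA dB / 4); first by rewrite divr_gt0.
  by rewrite -mulrDr gtr_pMr//; lra.
have [s [t [sh th E1]]] := mixed_difference x i j (ltW h0) sf.
have [s' [t' [sh' th' E2]]] := mixed_difference x j i (ltW h0) sf.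
have near k l u v : 0 <= u <= h -> 0 <= v <= h ->
    ball x (Num.min dA dB) (x + u *: e k + v *: e l).
  move=> /andP[u0 uh] /andP[v0 vh]; rewrite -ball_normE /ball_ /=.
  rewrite -addrA opprD addNKr normrN (le_lt_trans (ler_normD _ _))//.
  rewrite !normrZ !ger0_norm// (le_lt_trans _ hm)// lerD//.
    by rewrite (le_trans _ uh)// ler_piMr// basis2_norm_le1.
  by rewrite (le_trans _ vh)// ler_piMr// basis2_norm_le1.
have bA : ball x dA (x + s' *: e j + t' *: e i).
  by apply: le_ball (near _ _ _ _ sh' th'); rewrite ge_min lexx.
have bB : ball x dB (x + s *: e i + t *: e j).
  by apply: le_ball (near _ _ _ _ sh th); rewrite ge_min lexx orbT.
have eqAB : partial2 j (partial2 i f) (x + s *: e i + t *: e j) =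
          partial2 i (partial2 j f) (x + s' *: e j + t' *: e i).
  apply: (@mulfI _ (h ^+ 2)); first by rewrite expf_neq0// gt_eqF.
  apply: etrans (esym E1) (etrans _ E2).
  have -> : x + h *: e i + h *: e j = x + h *: e j + h *: e i by exact: addrAC.
  by congr (_ + _); exact: addrAC.
pose a := partial2 i (partial2 j f) (x + s' *: e j + t' *: e i).
have H1 : `|partial2 i (partial2 j f) x - a| < eps / 2 by exact: HA.
have H2 : `|a - partial2 j (partial2 i f) x| < eps / 2.
  by rewrite distrC /a -eqAB; exact: HB.
apply: (le_trans (ler_distD a _ _)).
by rewrite (splitr eps); exact: lerD (ltW H1) (ltW H2).
Qed.

End SmoothFunctions.

(** * Test functions *)

Section TestFunctions.
Variables (R : realType) (Omega : set (R * R)).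
Implicit Types (f g : R * R -> R) (i j : 'I_2).

Lemma test_fun_linear (a : R) f g : test_fun Omega f -> test_fun Omega g ->
  test_fun Omega (fun x => a * f x + g x).
Proof.
move=> [sf [K [cK KO f0]]] [sg [L [cL LO g0]]]; split; first exact: smooth2_linear.
exists (K `|` L); split.
- exact: compactU.
- by move=> x [/KO|/LO].
- by move=> x /not_orP[nK nL]; rewrite f0// g0// mulr0 addr0.
Qed.

(** The support is compact, hence closed, so the function vanishes near each point
    outside it. *)
Lemma test_fun_partial f j : test_fun Omega f -> test_fun Omega (partial2 j f).
Proof.
move=> [sf [K [cK KO f0]]]; split; first exact: smooth2_partial.
exists K; split=> // x nK; rewrite /partial2.
have oK : open (~` K).
  by apply: closed_openC; apply: compact_closed cK; exact: norm_hausdorff.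
have -> : 'D_(basis2 R j) f x = 'D_(basis2 R j) (cst 0) x; last exact: derive_cst.
apply: near_eq_derive.
have : nbhs x (~` K) by apply: open_nbhs_nbhs.
by apply: filterS => y; exact: f0.
Qed.

(** These are the test functions that yield the Poincare inequality. *)
Lemma test_fun_fst_mul f : test_fun Omega f ->
  test_fun Omega (fun x => x.1 * f x) /\
  forall j, partial2 j (fun x => x.1 * f x) =
    fun x => x.1 * partial2 j f x + (basis2 R j).1 * f x.
Proof.
move=> [sf [K [cK KO f0]]].
have s0 : smooth2 (fun x : R * R => -1 * f x + f x) by exact: smooth2_linear.
have E0 : (fun x : R * R => -1 * f x + f x) = cst 0.
  by apply/funext => x; rewrite mulN1r addNr.
have E : (fun x => x.1 * f x) = (fun x => x.1 * f x + (-1 * f x + f x)).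
  by apply/funext => x; rewrite mulN1r addNr addr0.
split.
  split; first by rewrite E; exact: smooth2_fst_mul.
  by exists K; split=> // x nK; rewrite f0// mulr0.
move=> j; apply/funext => x; rewrite [in LHS]E.
have [_ D] := derivable_fst_mul x j sf s0.
by apply: (etrans D); rewrite E0 [partial2 j (cst 0) x]derive_cst addr0.
Qed.

Hypotheses (oO : open Omega) (bO : bounded_set Omega).

(** A continuous function with compact support is bounded, and the bounded set
    [Omega] has finite measure. *)
Lemma test_fun_L2 f : test_fun Omega f -> in_Lp Omega 2%:E f.
Proof.
move=> [sf [K [cK KO f0]]].
have mO := open_measurable2 oO.
have cf := smooth2_continuous sf.
have mf : measurable_fun Omega (f : (measurableTypeR R * measurableTypeR R)%type -> R).
  by apply: (@measurable_funS _ _ _ _ setT) => //; exact: continuous_measurable2.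
change (L2on (leb2 R) Omega f).
apply: (L2on_of_sqr_integrable mO mf).
have cfK : compact (f @` K).
  by apply: continuous_compact cK; exact: continuous_subspaceT.
have [M [Mr HM]] := compact_bounded cfK.
have fM x : `|f x| <= `|M| + 1.
  have [Kx|nK] := pselect (K x).
    by apply: (HM (`|M| + 1)); [rewrite (le_lt_trans (ler_norm M))// ltrDl|exists x].
  by rewrite f0// normr0 addr_ge0.
apply: (measurable_bounded_integrable mO (bounded_leb2_lty mO bO)).
  exact: measurable_funM.
exists ((`|M| + 1) ^+ 2); split; first exact: num_real.
move=> N MN x _ /=; apply: (le_trans _ (ltW MN)).
by rewrite normrM expr2 ler_pM.
Qed.

End TestFunctions.

(** * Sobolev vector fields *)

Section SobolevFields.
Variables (R : realType) (Omega : set (R * R)).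
Implicit Types (f g : R * R -> R) (i j : 'I_2) (u v w : vfield R).
Local Notation L2 := (L2on (leb2 R) Omega).
Local Notation "<< f , g >>" := (ip (leb2 R) Omega f g).

Definition component i w : R * R -> R := fun x => value w x i ord0.
Definition dcomponent i j w : R * R -> R := fun x => grad w x i j.

(** The integrability part of [in_H1] and [in_V], which the test fields share. *)
Definition L2field w := (forall i, L2 (component i w)) /\ (forall i j, L2 (dcomponent i j w)).

Lemma component_linear a u v i :
  component i (a *: u + v) = fun x => a * component i u x + component i v x.
Proof. by apply/funext => x; rewrite /component /value /= !mxE. Qed.

Lemma dcomponent_linear a u v i j :
  dcomponent i j (a *: u + v) = fun x => a * dcomponent i j u x + dcomponent i j v x.
Proof. by apply/funext => x; rewrite /dcomponent /grad /= !mxE. Qed.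

Hypotheses (oO : open Omega) (bO : bounded_set Omega).
Let mO := open_measurable2 oO.

Lemma L2field_linear a u v : L2field u -> L2field v -> L2field (a *: u + v).
Proof.
move=> [u0 u1] [v0 v1]; split=> [i|i j].
- rewrite component_linear; exact: L2on_linear.
- rewrite dcomponent_linear; exact: L2on_linear.
Qed.

Lemma in_H1_L2field w : in_H1 Omega w -> L2field w.
Proof. by case=> w0 w1 _; split. Qed.

Definition norm_V_sqr w : R :=
  \sum_i << component i w, component i w >> + \sum_i \sum_j << dcomponent i j w, dcomponent i j w >>.

Lemma norm_VE w : L2field w -> norm_V Omega w = Num.sqrt (norm_V_sqr w).
Proof.
move=> [w0 w1]; congr Num.sqrt; rewrite /norm_V_sqr /tdot.
have I0 i := L2on_mul_integrable mO (w0 i) (w0 i).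
have I1 i j := L2on_mul_integrable mO (w1 i j) (w1 i j).
have I1s i := integrable_Rsum mO (index_enum 'I_2) (I1 i).
have e1 : \sum_i << component i w, component i w >> =
    \int[leb2 R]_(x in Omega) \sum_i (component i w x * component i w x).
  by rewrite Rintegral_sum.
have e2 : \sum_i \sum_j << dcomponent i j w, dcomponent i j w >> =
    \int[leb2 R]_(x in Omega) \sum_i \sum_j (dcomponent i j w x * dcomponent i j w x).
  rewrite Rintegral_sum//; apply: eq_bigr => i _.
  by rewrite Rintegral_sum.
rewrite e1 e2 -RintegralD//.
- by apply: eq_Rintegral => x _; congr (_ + _); apply: eq_bigr => i _; rewrite big_ord1.
- exact: (integrable_Rsum mO).
- exact: (integrable_Rsum mO).
Qed.

Lemma component_le_norm_V_sqr w i : << component i w, component i w >> <= norm_V_sqr w.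
Proof.
rewrite /norm_V_sqr (bigD1 i)//= -addrA lerDl addr_ge0//; apply: sumr_ge0 => k _.
  exact: ip_ge0.
by apply: sumr_ge0 => j _; exact: ip_ge0.
Qed.

Lemma dcomponent_le_norm_V_sqr w i j : << dcomponent i j w, dcomponent i j w >> <= norm_V_sqr w.
Proof.
rewrite /norm_V_sqr [X in _ + X](bigD1 i)//= [X in _ + (X + _)](bigD1 j)//=.
rewrite addrCA -!addrA lerDl !addr_ge0//; apply: sumr_ge0 => k _; try exact: ip_ge0.
by apply: sumr_ge0 => l _; exact: ip_ge0.
Qed.

Lemma ip_sqr_linear_le a f g : L2 f -> L2 g ->
  << (fun x => a * f x + g x), (fun x => a * f x + g x) >> <=
  2 * a ^+ 2 * <<f, f>> + 2 * <<g, g>>.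
Proof.
move=> Lf Lg; have := ip_ge0 (leb2 R) Omega (fun x => - a * f x + g x).
by rewrite !(ip_sqr_linear mO)//; move: <<f,f>> <<f,g>> <<g,g>> => X Y Z; nra.
Qed.

(** A substitute for the triangle inequality that works with squares. *)
Lemma norm_V_sqr_linear_le a u v : L2field u -> L2field v ->
  norm_V_sqr (a *: u + v) <= 2 * a ^+ 2 * norm_V_sqr u + 2 * norm_V_sqr v.
Proof.
move=> [u0 u1] [v0 v1]; rewrite /norm_V_sqr !mulrDr addrACA lerD// !mulr_sumr -big_split;
  apply: ler_sum => i _ /=.
  by rewrite component_linear; exact: ip_sqr_linear_le.
rewrite !mulr_sumr -big_split; apply: ler_sum => j _ /=.
by rewrite dcomponent_linear; exact: ip_sqr_linear_le.
Qed.

Definition test_field (phi : R * R -> 'cV[R]_2) :=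
  forall i, test_fun Omega (fun x => phi x i ord0).

Lemma dcomponent_of_smooth phi i j :
  dcomponent i j (of_smooth phi) = partial2 j (fun x => phi x i ord0).
Proof. by apply/funext => x; rewrite /dcomponent /grad /= mxE. Qed.

Lemma L2field_of_smooth phi : test_field phi -> L2field (of_smooth phi).
Proof.
move=> tphi; split=> [i|i j].
  exact: (test_fun_L2 oO bO (tphi i)).
rewrite dcomponent_of_smooth.
exact: (test_fun_L2 oO bO (test_fun_partial j (tphi i))).
Qed.

Lemma of_smooth_linear a phi chi : test_field phi -> test_field chi ->
  of_smooth (fun x => a *: phi x + chi x) = a *: of_smooth phi + of_smooth chi.
Proof.
move=> tphi tchi; congr pair; apply/funext => x; apply/matrixP => i j.
rewrite !mxE.
have [sphi _] := tphi i; have [schi _] := tchi i.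
have := partial2_linear a j sphi schi => /(congr1 (@^~ x)) <-.
by congr (partial2 j _ x); apply/funext => y; rewrite !mxE.
Qed.

Lemma test_field_linear a phi chi : test_field phi -> test_field chi ->
  test_field (fun x => a *: phi x + chi x).
Proof.
move=> tphi tchi i; have := test_fun_linear a (tphi i) (tchi i).
by congr (test_fun Omega _); apply/funext => x; rewrite !mxE.
Qed.

Lemma in_V_approx w : in_V Omega w -> forall e : R, 0 < e ->
  exists2 phi, test_field phi & norm_V_sqr (w - of_smooth phi) < e.
Proof.
move=> [/in_H1_L2field Lw aw] e e0.
have se : 0 < Num.sqrt e by rewrite sqrtr_gt0.
have [phi [tphi]] := aw _ se.
have E : w - of_smooth phi = (-1) *: of_smooth phi + w by rewrite scaleN1r addrC.
have Ld : L2field (w - of_smooth phi).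
  by rewrite E; apply: L2field_linear => //; exact: L2field_of_smooth.
by rewrite norm_VE// ltr_sqrt// => lte; exists phi.
Qed.

Lemma in_H1_linear a u v : in_H1 Omega u -> in_H1 Omega v ->
  in_H1 Omega (a *: u + v).
Proof.
move=> Hu Hv; have [Lu1 Lu2] := in_H1_L2field Hu; have [Lv1 Lv2] := in_H1_L2field Hv.
have [L1 L2] := L2field_linear a (in_H1_L2field Hu) (in_H1_L2field Hv).
split=> // f tf i j.
have Lf := test_fun_L2 oO bO tf.
have Ldf := test_fun_L2 oO bO (test_fun_partial j tf).
change (<< component i (a *: u + v), partial2 j f >> = - << dcomponent i j (a *: u + v), f >>).
rewrite component_linear dcomponent_linear !(ip_linear mO)//.
have [_ _ /(_ f tf i j) Iu] := Hu; have [_ _ /(_ f tf i j) Iv] := Hv.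
change (<< component i u, partial2 j f >> = - << dcomponent i j u, f >>) in Iu.
change (<< component i v, partial2 j f >> = - << dcomponent i j v, f >>) in Iv.
by rewrite Iu Iv mulrN opprD.
Qed.

Lemma in_V_linear a u v : in_V Omega u -> in_V Omega v -> in_V Omega (a *: u + v).
Proof.
move=> Vu Vv; have [Hu _] := Vu; have [Hv _] := Vv.
split; first exact: in_H1_linear.
move=> e e0.
(* the denominator is the constant of [norm_V_sqr_linear_le]; halving makes the
   final bound strict *)
pose d := e ^+ 2 / (2 * a ^+ 2 + 2) / 2.
have a2 : 0 < 2 * a ^+ 2 + 2 by have := sqr_ge0 a; lra.
have d0 : 0 < d by rewrite !divr_gt0// exprn_gt0.
have [phi tphi lphi] := in_V_approx Vu d0.
have [chi tchi lchi] := in_V_approx Vv d0.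
exists (fun x => a *: phi x + chi x); split; first exact: test_field_linear.
have Lp : L2field (u - of_smooth phi).
  have := L2field_linear (-1) (L2field_of_smooth tphi) (in_H1_L2field Hu).
  by rewrite scaleN1r addrC.
have Lc : L2field (v - of_smooth chi).
  have := L2field_linear (-1) (L2field_of_smooth tchi) (in_H1_L2field Hv).
  by rewrite scaleN1r addrC.
rewrite (of_smooth_linear a tphi tchi).
have -> : a *: u + v - (a *: of_smooth phi + of_smooth chi) =
   a *: (u - of_smooth phi) + (v - of_smooth chi).
  by rewrite scalerBr opprD addrACA.
rewrite norm_VE; last exact: L2field_linear.
rewrite -(ger0_norm (ltW e0)) -sqrtr_sqr ltr_sqrt ?exprn_gt0//.
apply: (le_lt_trans (norm_V_sqr_linear_le a Lp Lc)).
apply: (@le_lt_trans _ _ ((2 * a ^+ 2 + 2) * d)).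
  rewrite (mulrDl (2 * a ^+ 2) 2 d) lerD//.
    by rewrite ler_wpM2l ?(ltW lphi)// mulr_ge0// sqr_ge0.
  by rewrite ler_wpM2l ?(ltW lchi).
have -> : (2 * a ^+ 2 + 2) * d = e ^+ 2 / 2 by rewrite /d; field; rewrite gt_eqF.
by rewrite ltr_pdivrMr// ltr_pMr ?ltr1n// exprn_gt0.
Qed.

End SobolevFields.

(** * Korn and Poincare inequalities *)

Section KornPoincare.
Variables (R : realType) (Omega : set (R * R)).
Implicit Types (f g : R * R -> R) (i j : 'I_2) (u v w : vfield R).
Local Notation L2 := (L2on (leb2 R) Omega).
Local Notation "<< f , g >>" := (ip (leb2 R) Omega f g).
Local Notation norm2 f := (Num.sqrt << f, f >>).
Local Notation i0 := (ord0 : 'I_2).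
Local Notation i1 := (lift ord0 ord0 : 'I_2).

Hypotheses (oO : open Omega) (bO : bounded_set Omega).
Let mO := open_measurable2 oO.
(** [ipC] at this measure: the measurable structure of the plane cannot be read
    off the functions. *)
Let ipS f g : << f, g >> = << g, f >> := @ipC _ _ _ (leb2 R) Omega f g.

(** The left-hand side is linear in [phi] and, by Cauchy-Schwarz, continuous for
    the norm of V, and V is the closure of the test fields. *)
Lemma test_identity_extends a b0 b1 : L2 a -> L2 b0 -> L2 b1 ->
  (forall phi, test_fun Omega phi ->
     << a, phi >> + << b0, partial2 i0 phi >> + << b1, partial2 i1 phi >> = 0) ->
  forall w m, in_V Omega w ->
  << a, component m w >> + << b0, dcomponent m i0 w >> + << b1, dcomponent m i1 w >> = 0.
Proof.
move=> La Lb0 Lb1 H w m Vw; set S := _ + _.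
set K := norm2 a + norm2 b0 + norm2 b1.
have K0 : 0 <= K by rewrite !addr_ge0// sqrtr_ge0.
have [Lw0 Lw1] := in_H1_L2field Vw.1.
have bound e : 0 < e -> `|S| <= K * Num.sqrt e.
  move=> e0; have [phi tphi lphi] := in_V_approx oO bO Vw e0.
  have [Lp0 Lp1] := L2field_of_smooth oO bO tphi.
  have Ew : w - of_smooth phi = (-1) *: of_smooth phi + w by rewrite scaleN1r addrC.
  have [Ld0 Ld1] : L2field Omega (w - of_smooth phi).
    by rewrite Ew; exact: (L2field_linear _ (L2field_of_smooth oO bO tphi) (in_H1_L2field Vw.1)).
  have small f : << f, f >> <= norm_V_sqr Omega (w - of_smooth phi) -> norm2 f <= Num.sqrt e.
    by move=> fV; rewrite ler_wsqrtr// (le_trans fV)// ltW.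
  have -> : S = << a, component m (w - of_smooth phi) >> +
      << b0, dcomponent m i0 (w - of_smooth phi) >> + << b1, dcomponent m i1 (w - of_smooth phi) >>.
    have Hm := H _ (tphi m).
    rewrite Ew component_linear !dcomponent_linear.
    rewrite ![<< a, _ >>]ipS ![<< b0, _ >>]ipS ![<< b1, _ >>]ipS !(ip_linear mO)//.
    rewrite ![<< _, a >>]ipS ![<< _, b0 >>]ipS ![<< _, b1 >>]ipS !dcomponent_of_smooth.
    rewrite /S; move: Hm; rewrite -[component m (of_smooth phi)]/(fun x => phi x m ord0).
    clear; move: << a, component m w >> << b0, dcomponent m i0 w >>
      << b1, dcomponent m i1 w >> << a, _ >> << b0, partial2 _ _ >>
      << b1, partial2 _ _ >> => x y z x' y' z' Hm.
    by rewrite -[LHS]subr0 -Hm; ring.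
  rewrite /K !mulrDl.
  apply: (le_trans (ler_normD _ _)); apply: lerD.
    apply: (le_trans (ler_normD _ _)); apply: lerD.
      apply: (le_trans (ip_cauchy_schwarz mO La (Ld0 m))).
      by rewrite ler_wpM2l ?sqrtr_ge0// small//; exact: component_le_norm_V_sqr.
    apply: (le_trans (ip_cauchy_schwarz mO Lb0 (Ld1 m i0))).
    by rewrite ler_wpM2l ?sqrtr_ge0// small//; exact: dcomponent_le_norm_V_sqr.
  apply: (le_trans (ip_cauchy_schwarz mO Lb1 (Ld1 m i1))).
  by rewrite ler_wpM2l ?sqrtr_ge0// small//; exact: dcomponent_le_norm_V_sqr.
clearbody K S; apply/eqP/negPn/negP => S0.
have S2 : 0 < S ^+ 2 by rewrite exprn_even_gt0.
have K1 : 0 < K ^+ 2 + 1 by rewrite ltr_wpDl// sqr_ge0.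
(* this [e] turns the bound into [S ^+ 2 * (K ^+ 2 + 1) <= K ^+ 2 * S ^+ 2] *)
have e0 := divr_gt0 S2 K1; set e := S ^+ 2 / _ in e0.
have : S ^+ 2 <= K ^+ 2 * e.
  rewrite -(sqr_sqrtr (ltW e0)) -exprMn -[S ^+ 2]real_normK ?num_real//.
  by apply: lerXn2r; rewrite ?nnegrE ?mulr_ge0 ?sqrtr_ge0//; exact: bound.
by rewrite mulrA ler_pdivlMr// mulrC ler_pM2r// -subr_ge0 opprD addrA subrr sub0r oppr_ge0 ler10.
Qed.

Lemma in_H1_by_parts w f i j : in_H1 Omega w -> test_fun Omega f ->
  << component i w, partial2 j f >> = - << dcomponent i j w, f >>.
Proof. by move=> [_ _ +] tf => /(_ f tf i j). Qed.

(** For a test function [phi] in place of the second component, moving the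
    derivatives of the first component onto [phi] turns both sides into the
    integral against a mixed second derivative of [phi].  Density of the test
    functions is where vanishing on the boundary enters Korn's inequality. *)
Lemma ip_cross_derivatives w : in_V Omega w ->
  << dcomponent i0 i1 w, dcomponent i1 i0 w >> = << dcomponent i0 i0 w, dcomponent i1 i1 w >>.
Proof.
move=> Vw; have [Lw0 Lw1] := in_H1_L2field Vw.1.
have LN : L2 (fun x => (-1) * dcomponent i0 i0 w x) by exact: (L2onZ mO).
have := @test_identity_extends _ _ _ (L2on0 (leb2 R) mO) (Lw1 i0 i1) LN _ w i1 Vw.
rewrite (ip0l _ mO) add0r (ipZl mO)// mulN1r => H.
apply/eqP; rewrite -subr_eq0; apply/eqP/H => phi tphi.
have t0 := test_fun_partial i0 tphi; have t1 := test_fun_partial i1 tphi.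
rewrite (ip0l _ mO) add0r (ipZl mO)//; last exact: (test_fun_L2 oO bO t1).
apply/eqP; rewrite mulN1r subr_eq0 -eqr_opp.
have h1 := in_H1_by_parts i0 i1 Vw.1 t0; have h2 := in_H1_by_parts i0 i0 Vw.1 t1.
by apply/eqP; apply: etrans (esym h1) (etrans _ h2); rewrite (partial2_swap i1 i0 tphi.1).
Qed.

Definition strain_comp i j w : R * R -> R := fun x => strain w x i j.

Definition strain_sqr w : R := \sum_i \sum_j << strain_comp i j w, strain_comp i j w >>.

Definition dcomponent_sqr w : R := \sum_i \sum_j << dcomponent i j w, dcomponent i j w >>.

Lemma strain_compE i j w :
  strain_comp i j w = fun x => 2^-1 * dcomponent i j w x + 2^-1 * dcomponent j i w x.
Proof. by apply/funext => x; rewrite /strain_comp /strain !mxE mulrDr. Qed.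

Lemma L2_strain i j w : L2field Omega w -> L2 (strain_comp i j w).
Proof.
by move=> [_ L1]; rewrite strain_compE; apply: L2on_linear => //; exact: (L2onZ mO).
Qed.

Lemma divergenceE w : divergence w = fun x => dcomponent i0 i0 w x + dcomponent i1 i1 w x.
Proof. by apply/funext => x; rewrite /divergence /mxtrace big_ord_recl big_ord1. Qed.

Lemma L2_divergence w : L2field Omega w -> L2 (divergence w).
Proof. by move=> [_ L1]; rewrite divergenceE; exact: L2onD. Qed.

(** Expanding the square of the strain leaves the cross term of
    [ip_cross_derivatives]; once it is replaced, twice the squared strain is the
    squared gradient plus the squared divergence. *)
Lemma korn w : in_V Omega w -> dcomponent_sqr w <= 2 * strain_sqr w.
Proof.
move=> Vw; have Lw := in_H1_L2field Vw.1; have [_ Lw1] := Lw.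
have cross := ip_cross_derivatives Vw.
have Estrain i j : << strain_comp i j w, strain_comp i j w >> =
   4^-1 * (<< dcomponent i j w, dcomponent i j w >> + 2 * << dcomponent i j w, dcomponent j i w >> +
           << dcomponent j i w, dcomponent j i w >>).
  have Lh := L2onZ mO 2^-1 (Lw1 j i).
  rewrite strain_compE (ip_sqr_linear mO (2^-1) (Lw1 i j) Lh).
  by rewrite !(ipZr mO)// (ipZl mO)//; field.
have := ip_ge0 (leb2 R) Omega (divergence w).
have -> : divergence w = fun x => 1 * dcomponent i0 i0 w x + dcomponent i1 i1 w x.
  by rewrite divergenceE; apply/funext => x; rewrite mul1r.
rewrite (ip_sqr_linear mO)// -cross expr1n mul1r mulr1.
rewrite /strain_sqr /dcomponent_sqr !big_ord_recl !big_ord0 !addr0 !Estrain.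
rewrite (ipS (dcomponent i1 i0 w) (dcomponent i0 i1 w)).
move: << dcomponent i0 i0 w, dcomponent i0 i0 w >> << dcomponent i0 i1 w, dcomponent i1 i0 w >>
  << dcomponent i0 i1 w, dcomponent i0 i1 w >> << dcomponent i1 i0 w, dcomponent i1 i0 w >>
  << dcomponent i1 i1 w, dcomponent i1 i1 w >> => a b c d e.
lra.
Qed.

Lemma fst_bounded : exists2 M : R, 0 <= M & forall x, Omega x -> `|x.1| <= M.
Proof.
have [M [_ bM]] := bO; exists (`|M| + 1) => [|x Ox]; first by rewrite addr_ge0.
have := bM (`|M| + 1); rewrite (le_lt_trans (ler_norm M)) ?ltrDl// => /(_ isT x Ox).
by rewrite /= prod_normE ge_max => /andP[].
Qed.

Lemma mul_fst_L2 M f : (forall x, Omega x -> `|x.1| <= M) -> L2 f ->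
  L2 (fun x => x.1 * f x).
Proof.
move=> bM Lf; apply: (L2on_dominated mO _ (L2onZ mO M Lf)).
  apply: measurable_funM; last exact: (L2on_measurable mO Lf).
  exact: measurable_funS (@measurable_fst _ _ _ _).
move=> x Ox; rewrite !normrM ler_wpM2r//.
exact: le_trans (bM _ Ox) (ler_norm _).
Qed.

(** Formally, integrate [x.1] times the derivative of the square of the component:
    the first coordinate has derivative 1.  Weakly, test with [x.1 * phi] and let
    [phi] tend to the component. *)
Lemma poincare_identity w i : in_V Omega w ->
  << component i w, component i w >> =
  - 2 * \int[leb2 R]_(x in Omega) (x.1 * (component i w x * dcomponent i i0 w x)).
Proof.
move=> Vw; have [Lw0 Lw1] := in_H1_L2field Vw.1.
have [M M0 fstM] := fst_bounded.
(* testing the weak derivative with [x.1 * phi] gives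
   [<< a, phi >> + << b, partial2 i0 phi >> = 0] *)
pose a x := 1 * component i w x + x.1 * dcomponent i i0 w x.
pose b x := x.1 * component i w x.
have Lb : L2 b by exact: mul_fst_L2 fstM _.
have Lx : L2 (fun x => x.1 * dcomponent i i0 w x) by exact: mul_fst_L2 fstM _.
have La : L2 a by exact: L2on_linear.
have shift_fst f g : << (fun x => x.1 * f x), g >> = << f, (fun x => x.1 * g x) >>.
  by apply: eq_Rintegral => x _; rewrite mulrCA mulrA.
have := @test_identity_extends a b (fun=> 0) La Lb (L2on0 (leb2 R) mO) _ w i Vw.
rewrite (ip0l _ mO) addr0 (ip_linear mO)// mul1r.
have -> : << (fun x => x.1 * dcomponent i i0 w x), component i w >> =
    \int[leb2 R]_(x in Omega) (x.1 * (component i w x * dcomponent i i0 w x)).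
  by apply: eq_Rintegral => x _; rewrite -mulrA (mulrC (component i w x)).
have -> : << b, dcomponent i i0 w >> =
    \int[leb2 R]_(x in Omega) (x.1 * (component i w x * dcomponent i i0 w x)).
  by apply: eq_Rintegral => x _; rewrite mulrA.
move=> H; apply/eqP; rewrite -subr_eq0 mulNr opprK mulr_natl mulr2n addrA; apply/eqP/H.
move=> phi tphi; have [txphi dxphi] := test_fun_fst_mul tphi.
have Lphi := test_fun_L2 oO bO tphi.
have Ldphi := test_fun_L2 oO bO (test_fun_partial i0 tphi).
rewrite (ip0l _ mO) addr0 (ip_linear mO)// mul1r !shift_fst.
rewrite -[X in _ + X + _]opprK -(in_H1_by_parts i i0 Vw.1 txphi) dxphi.
have -> : (fun x => x.1 * partial2 i0 phi x + (basis2 R i0).1 * phi x) =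
   (fun x => 1 * (x.1 * partial2 i0 phi x) + phi x).
  by apply/funext => x; rewrite /basis2 eqxx !mul1r.
rewrite (ipS _ (fun x => _ + _)) (ip_linear mO)//; last exact: (mul_fst_L2 fstM).
by rewrite mul1r !(ipS (component i w)) opprD addrCA subrr addr0 addNr.
Qed.

(** If the first coordinate is at most [M] on [Omega], the identity and
    Cauchy-Schwarz bound the squared norm of the component by [2 * M] times the
    product of the two norms; completing a square absorbs the norm of the component. *)
Lemma poincare : exists2 P : R, 0 <= P & forall w i, in_V Omega w ->
  << component i w, component i w >> <= P * << dcomponent i i0 w, dcomponent i i0 w >>.
Proof.
have [M M0 fstM] := fst_bounded.
exists (4 * M ^+ 2); first by rewrite mulr_ge0// sqr_ge0.
move=> w i Vw; have [Lw0 Lw1] := in_H1_L2field Vw.1.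
have cb : ae_bounded_on (leb2 R) Omega M fst.
  split; last by apply: nearW => x; exact: fstM.
  exact: measurable_funS (@measurable_fst _ _ _ _).
have I_le := weighted_ip_le mO M0 cb (Lw0 i) (Lw1 i i0).
have I_eq := poincare_identity i Vw.
have A2 := sqr_sqrtr (ip_ge0 (leb2 R) Omega (component i w)).
have B2 := sqr_sqrtr (ip_ge0 (leb2 R) Omega (dcomponent i i0 w)).
rewrite -A2 in I_eq *; rewrite -B2.
set A := Num.sqrt << component i w, _ >> in I_le I_eq *.
set B := Num.sqrt _ in I_le *.
set I := Rintegral _ _ _ in I_le I_eq.
have AMB : A ^+ 2 <= 2 * (M * (A * B)).
  by rewrite I_eq mulNr -mulrN ler_pM2l// (le_trans _ I_le)// -normrN ler_norm.
have := sqr_ge0 (2 * M * B - A); move: AMB; clear.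
by clearbody A B; nra.
Qed.

(** This constant carries the dependence of the final estimate on [Omega]. *)
Lemma norm_V_sqr_le_strain : exists2 K : R, 0 < K &
  forall w, in_V Omega w -> norm_V_sqr Omega w <= K * strain_sqr w.
Proof.
have [P P0 HP] := poincare; exists (2 * (P + 1)); first by rewrite mulr_gt0// ltr_wpDl.
move=> w Vw; rewrite -mulrA mulrCA; apply: (@le_trans _ _ ((P + 1) * dcomponent_sqr w)).
  rewrite mulrDl mul1r lerD// /dcomponent_sqr mulr_sumr; apply: ler_sum => i _.
  apply: (le_trans (HP _ i Vw)); rewrite ler_wpM2l// big_ord_recl lerDl.
  by apply: sumr_ge0 => j _; exact: ip_ge0.
by rewrite ler_wpM2l ?addr_ge0//; exact: korn.
Qed.

End KornPoincare.

(** * Bounded functionals on V *)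

Section DualNorm.
Variables (R : realType) (Omega : set (R * R)).
Hypotheses (oO : open Omega) (bO : bounded_set Omega).
Let mO := open_measurable2 oO.
Implicit Types (l : vfield R -> R) (w u v : vfield R).

Lemma in_V0 w : in_V Omega w -> in_V Omega (0 : vfield R).
Proof.
by move=> Vw; have := in_V_linear oO bO (-1) Vw Vw; rewrite scaleN1r addNr.
Qed.

Lemma dual0 l w : in_dual Omega l -> in_V Omega w -> l 0 = 0.
Proof.
move=> [lin _] /in_V0 V0; have := lin 1 _ _ V0 V0.
by rewrite scaler0 addr0 mul1r -[LHS]addr0 => /addrI.
Qed.

Lemma dualZ l a w : in_dual Omega l -> in_V Omega w -> l (a *: w) = a * l w.
Proof.
move=> dl Vw; have := dl.1 a w 0 Vw (in_V0 Vw).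
by rewrite (dual0 dl Vw) !addr0.
Qed.

Lemma dualB l u v : in_dual Omega l -> in_V Omega u -> in_V Omega v ->
  l (u - v) = l u - l v.
Proof.
move=> dl Vu Vv; have := dl.1 (-1) v u Vv Vu.
by rewrite scaleN1r addrC mulN1r (addrC (- _)).
Qed.

Lemma norm_VZ a w : in_V Omega w -> norm_V Omega (a *: w) = `|a| * norm_V Omega w.
Proof.
move=> Vw; have Lw := in_H1_L2field Vw.1; have L0 := in_H1_L2field (in_V0 Vw).1.
have Laz := L2field_linear a Lw L0; rewrite addr0 in Laz.
rewrite (norm_VE oO Lw) (norm_VE oO Laz) -sqrtr_sqr -sqrtrM ?sqr_ge0//; congr Num.sqrt.
have [Lw0 Lw1] := Lw.
rewrite /norm_V_sqr mulrDr !mulr_sumr; congr (_ + _); apply: eq_bigr => i _.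
  rewrite (_ : component i (a *: w) = fun x => a * component i w x).
    by rewrite (ipZl mO) ?(ipZr mO) ?mulrA//; exact: (L2onZ mO).
  by apply/funext => x; rewrite /component /value /= !mxE.
rewrite mulr_sumr; apply: eq_bigr => j _.
rewrite (_ : dcomponent i j (a *: w) = fun x => a * dcomponent i j w x).
  by rewrite (ipZl mO) ?(ipZr mO) ?mulrA//; exact: (L2onZ mO).
by apply/funext => x; rewrite /dcomponent /grad /= !mxE.
Qed.

Lemma norm_V_ge0 w : 0 <= norm_V Omega w.
Proof. exact: sqrtr_ge0. Qed.

(** The supremum only sees the unit ball; fields of norm zero, which cannot be
    rescaled to norm 1, are killed by any bounded functional. *)
Lemma dual_le l w : in_dual Omega l -> in_V Omega w ->
  `|l w| <= norm_dual Omega l * norm_V Omega w.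
Proof.
move=> dl Vw; have [M lM] := dl.2.
have [w0|w0] := eqVneq (norm_V Omega w) 0.
  by have := lM _ Vw; rewrite w0 !mulr0.
have wgt0 : 0 < norm_V Omega w by rewrite lt_def w0 norm_V_ge0.
set a := (norm_V Omega w)^-1.
have a0 : 0 < a by rewrite invr_gt0.
have Vaw : in_V Omega (a *: w).
  by have := in_V_linear oO bO a Vw (in_V0 Vw); rewrite addr0.
have Naw : norm_V Omega (a *: w) = 1.
  by rewrite norm_VZ// gtr0_norm// mulVf.
have : `|l (a *: w)| <= norm_dual Omega l.
  apply: ub_le_sup; last by exists (a *: w) => //; split=> //; rewrite Naw.
  exists `|M| => _ [v [Vv v1] <-]; apply: (le_trans (lM _ Vv)).
  apply: (le_trans (ler_norm _)); rewrite normrM (ger0_norm (norm_V_ge0 v)).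
  by rewrite ler_piMr.
by rewrite dualZ// normrM (gtr0_norm a0) mulrC ler_pdivrMr.
Qed.

Lemma norm_dual_ge0 l w : in_dual Omega l -> in_V Omega w -> 0 <= norm_dual Omega l.
Proof.
move=> dl Vw; have [M lM] := dl.2; have V0 := in_V0 Vw.
have N0 : norm_V Omega 0 = 0.
  by rewrite -(scale0r w) norm_VZ// normr0 mul0r.
apply: (@le_trans _ _ `|l 0|) => //.
apply: ub_le_sup; last by exists 0 => //; split=> //; rewrite N0.
exists `|M| => _ [v [Vv v1] <-]; apply: (le_trans (lM _ Vv)).
apply: (le_trans (ler_norm _)); rewrite normrM (ger0_norm (norm_V_ge0 v)).
by rewrite ler_piMr.
Qed.

End DualNorm.

(** * The elasticity form *)

Section Energy.
Variables (R : realType) (Omega : set (R * R)).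
Hypotheses (oO : open Omega) (bO : bounded_set Omega).
Let mO := open_measurable2 oO.
Implicit Types (m l c f g h : R * R -> R) (w u v : vfield R).
Local Notation L2 := (L2on (leb2 R) Omega).
Local Notation "<< f , g >>" := (ip (leb2 R) Omega f g).
Local Notation norm2 f := (Num.sqrt << f, f >>).

Definition essbounded c := exists M, ae_bounded_on (leb2 R) Omega M c.

Definition weighted_ip c f g : R := \int[leb2 R]_(x in Omega) (c x * (f x * g x)).

Lemma weighted_ip_integrable c f g : essbounded c -> L2 f -> L2 g ->
  (leb2 R).-integrable Omega (EFin \o (fun x => c x * (f x * g x))).
Proof.
move=> [M cM] Lf Lg; apply: (ae_bounded_mul_integrable mO cM).
exact: L2on_mul_integrable.
Qed.

Lemma weighted_ip_subl c f g h : essbounded c -> L2 f -> L2 g -> L2 h ->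
  weighted_ip c (fun x => f x - g x) h = weighted_ip c f h - weighted_ip c g h.
Proof.
move=> cc Lf Lg Lh; rewrite /weighted_ip -RintegralB//; try exact: weighted_ip_integrable.
by apply: eq_Rintegral => x _; rewrite mulrBl mulrBr.
Qed.

Lemma weighted_ip_subc c c' f g : essbounded c -> essbounded c' -> L2 f -> L2 g ->
  weighted_ip (fun x => c x - c' x) f g = weighted_ip c f g - weighted_ip c' f g.
Proof.
move=> cc cc' Lf Lg; rewrite /weighted_ip -RintegralB//; try exact: weighted_ip_integrable.
by apply: eq_Rintegral => x _; rewrite mulrBl.
Qed.

Lemma essboundedZ a c : essbounded c -> essbounded (fun x => a * c x).
Proof.
move=> [M [mc cM]]; exists (`|a| * M); split; first exact: measurable_funM.
by apply: filterS cM => x + Ox => /(_ Ox) cM; rewrite normrM ler_wpM2l.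
Qed.

Lemma essboundedB c c' : essbounded c -> essbounded c' -> essbounded (fun x => c x - c' x).
Proof.
move=> [M [mc cM]] [M' [mc' cM']]; exists (M + M'); split; first exact: measurable_funB.
apply: filterS2 cM cM' => x + + Ox => /(_ Ox) cM /(_ Ox) cM'.
by rewrite (le_trans (ler_normB _ _))// lerD.
Qed.

(** Reduces every property of the form to the weighted scalar integrals. *)
Lemma bformE m l u v : essbounded m -> essbounded l -> L2field Omega u -> L2field Omega v ->
  bform Omega m l u v =
  \sum_i \sum_j weighted_ip (fun x => 2 * m x) (strain_comp i j u) (strain_comp i j v)
  + weighted_ip l (divergence u) (divergence v).
Proof.
move=> cm cl Lu Lv; have c2m := essboundedZ 2 cm.
have I1 i j := weighted_ip_integrable c2m (L2_strain oO i j Lu) (L2_strain oO i j Lv).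
have I1s i := integrable_Rsum mO (index_enum 'I_2) (I1 i).
have -> : \sum_i \sum_j weighted_ip (fun x => 2 * m x) (strain_comp i j u) (strain_comp i j v) =
    \int[leb2 R]_(x in Omega)
      \sum_i \sum_j (2 * m x * (strain_comp i j u x * strain_comp i j v x)).
  rewrite Rintegral_sum//; apply: eq_bigr => i _.
  by rewrite Rintegral_sum.
rewrite -RintegralD//; last 2 first.
- exact: (integrable_Rsum mO).
- by apply: weighted_ip_integrable => //; exact: L2_divergence.
apply: eq_Rintegral => x _; congr (_ + _); rewrite /tdot mulr_sumr.
by apply: eq_bigr => i _; rewrite mulr_sumr.
Qed.

Lemma strain_compB i j u v :
  strain_comp i j (u - v) = fun x => strain_comp i j u x - strain_comp i j v x.
Proof.
apply/funext => x; rewrite /strain_comp /strain /grad /= !mxE; ring.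
Qed.

Lemma divergenceB u v : divergence (u - v) = fun x => divergence u x - divergence v x.
Proof. by apply/funext => x; rewrite /divergence /grad /= mxtraceD raddfN. Qed.

Lemma bform_subl m l u v w : essbounded m -> essbounded l ->
  L2field Omega u -> L2field Omega v -> L2field Omega w ->
  bform Omega m l (u - v) w = bform Omega m l u w - bform Omega m l v w.
Proof.
move=> cm cl Lu Lv Lw; have c2m := essboundedZ 2 cm.
have Luv : L2field Omega (u - v).
  by have := L2field_linear (-1) Lv Lu; rewrite scaleN1r addrC.
rewrite !bformE// opprD addrACA; congr (_ + _).
  rewrite -sumrB; apply: eq_bigr => i _; rewrite -sumrB; apply: eq_bigr => j _.
  by rewrite strain_compB weighted_ip_subl//; exact: L2_strain.
by rewrite divergenceB weighted_ip_subl//; exact: L2_divergence.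
Qed.

Lemma bform_subc m m' l l' u v : essbounded m -> essbounded m' -> essbounded l -> essbounded l' ->
  L2field Omega u -> L2field Omega v ->
  bform Omega (fun x => m x - m' x) (fun x => l x - l' x) u v =
  bform Omega m l u v - bform Omega m' l' u v.
Proof.
move=> cm cm' cl cl' Lu Lv; have c2m := essboundedZ 2 cm; have c2m' := essboundedZ 2 cm'.
rewrite !bformE//; try exact: essboundedB.
rewrite opprD addrACA; congr (_ + _); last first.
  by rewrite weighted_ip_subc//; exact: L2_divergence.
rewrite -sumrB; apply: eq_bigr => i _; rewrite -sumrB; apply: eq_bigr => j _.
rewrite -weighted_ip_subc//; try exact: L2_strain.
by congr weighted_ip; apply/funext => x; rewrite mulrBr.
Qed.

Definition strain_norm w := Num.sqrt (strain_sqr Omega w).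

(** The factor [sqrt Lam] splits the factor [Lam] of the second Lame coefficient
    evenly between the two arguments of the form. *)
Definition div_norm (Lam : R) w := Num.sqrt Lam * norm2 (divergence w).

Lemma strain_sqr_ge0 w : 0 <= strain_sqr Omega w.
Proof. by do 2 (apply: sumr_ge0 => ? _); exact: ip_ge0. Qed.

Lemma strain_comp_le i j w : norm2 (strain_comp i j w) <= strain_norm w.
Proof.
rewrite ler_wsqrtr// /strain_sqr (bigD1 i)//= (bigD1 j)//= -addrA lerDl addr_ge0//.
  by apply: sumr_ge0 => ? _; exact: ip_ge0.
by do 2 (apply: sumr_ge0 => ? _); exact: ip_ge0.
Qed.

(** The constant 8 accounts for the four entries of the strain, each entering the
    form with the factor 2. *)
Lemma bform_le (T Lam : R) m l u v : 0 <= T -> 0 <= Lam ->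
  ae_bounded_on (leb2 R) Omega T m ->
  ae_bounded_on (leb2 R) Omega (Lam * T) l ->
  L2field Omega u -> L2field Omega v ->
  `|bform Omega m l u v| <=
  8 * T * (strain_norm u * strain_norm v + div_norm Lam u * div_norm Lam v).
Proof.
move=> T0 Lam0 mT lT Lu Lv.
have cm : essbounded m by exists T.
have cl : essbounded l by exists (Lam * T).
have c2m : ae_bounded_on (leb2 R) Omega (2 * T) (fun x => 2 * m x).
  have [mm mb] := mT; split; first exact: measurable_funM.
  by apply: filterS mb => x + Ox => /(_ Ox) mb; rewrite normrM normr_nat ler_pM2l.
rewrite bformE// mulrDr (le_trans (ler_normD _ _))// lerD//.
  have st i j : `|weighted_ip (fun x => 2 * m x) (strain_comp i j u) (strain_comp i j v)|
      <= 2 * T * (strain_norm u * strain_norm v).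
    apply: (le_trans (weighted_ip_le mO _ c2m (L2_strain oO i j Lu) (L2_strain oO i j Lv))).
      by rewrite mulr_ge0.
    by rewrite ler_wpM2l ?mulr_ge0// ler_pM ?sqrtr_ge0// strain_comp_le.
  rewrite !big_ord_recl !big_ord0 !addr0.
  move: (st ord0 ord0) (st ord0 (lift ord0 ord0)) (st (lift ord0 ord0) ord0)
    (st (lift ord0 ord0) (lift ord0 ord0)).
  move: (weighted_ip _ _ _) (weighted_ip _ _ _) (weighted_ip _ _ _) (weighted_ip _ _ _)
    (strain_norm u * _) => a b c d X.
  rewrite !ler_norml => /andP[? ?] /andP[? ?] /andP[? ?] /andP[? ?].
  by apply/andP; split; lra.
have LT : 0 <= Lam * T by rewrite mulr_ge0.
apply: (le_trans (weighted_ip_le mO LT lT (L2_divergence Lu) (L2_divergence Lv))).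
have -> : div_norm Lam u * div_norm Lam v =
    Lam * (norm2 (divergence u) * norm2 (divergence v)).
  by rewrite /div_norm mulrACA -expr2 sqr_sqrtr.
rewrite [leRHS]mulrA ler_wpM2r ?mulr_ge0 ?sqrtr_ge0//.
by rewrite (mulrC (8 * T)) ler_wpM2l// ler_peMl// ler1n.
Qed.

Lemma bform_ge (g Lam : R) m l w : 0 <= Lam -> essbounded m -> essbounded l ->
  {ae leb2 R, forall x, Omega x -> g <= m x} ->
  {ae leb2 R, forall x, Omega x -> Lam * g <= l x} -> 0 <= g ->
  L2field Omega w ->
  g * (strain_norm w ^+ 2 + div_norm Lam w ^+ 2) <= bform Omega m l w w.
Proof.
move=> Lam0 cm cl mg lg g0 Lw; have [M2 c2m] := essboundedZ 2 cm.
rewrite bformE// mulrDr lerD//.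
  rewrite sqr_sqrtr ?strain_sqr_ge0// /strain_sqr mulr_sumr; apply: ler_sum => i _.
  rewrite mulr_sumr; apply: ler_sum => j _.
  apply: (weighted_ip_ge mO c2m (L2_strain oO i j Lw)).
  apply: (@ae_on_impl _ _ _ (leb2 R) Omega _ _ _ mg) => x _ gm.
  by rewrite (le_trans gm)// ler_peMl ?ler1n// (le_trans g0).
rewrite exprMn !sqr_sqrtr ?ip_ge0// mulrA (mulrC g).
by have [M cM] := cl; exact: (weighted_ip_ge mO cM (L2_divergence Lw)).
Qed.

End Energy.

(** * Perturbation of the coefficients *)

(** The algebra of the energy estimate: the work of the load is bounded by the
    strain norm [X] alone, yet the divergence norm [Y] is controlled as well. *)
Lemma sqr_le_linear (R : realFieldType) (g c X Y : R) : 0 < g -> 0 <= c -> 0 <= X -> 0 <= Y ->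
  g * (X ^+ 2 + Y ^+ 2) <= c * X -> X <= c / g /\ Y <= c / g.
Proof.
move=> g0 c0 X0 Y0 H; rewrite !ler_pdivlMr//.
have H2 : (g * X) ^+ 2 + (g * Y) ^+ 2 <= c * (g * X).
  rewrite (mulrCA c) (_ : _ + _ = g * (g * (X ^+ 2 + Y ^+ 2))); last by ring.
  by rewrite ler_pM2l.
have gX : 0 <= g * X by rewrite mulr_ge0// ltW.
have gY : 0 <= g * Y by rewrite mulr_ge0// ltW.
rewrite !(mulrC _ g); move: (g * X) (g * Y) gX gY H2 => {X0 Y0 H}x y x0 y0 H.
have y2 := sqr_ge0 y; have x2 := sqr_ge0 (2 * x - c).
by split; rewrite leNgt; apply/negP => cx; nra.
Qed.

(** The algebra of the error estimate: [X] and [Y] measure the known solution, [P]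
    and [Q] the error. *)
Lemma sqr_le_bilinear (R : realFieldType) (g A B X Y P Q : R) :
  0 < g -> 0 <= A -> 0 <= B -> 0 <= P -> 0 <= Q -> X <= A -> Y <= A ->
  g * (P ^+ 2 + Q ^+ 2) <= B * (X * P + Y * Q) -> P <= 2 * A * B / g.
Proof.
move=> g0 A0 B0 P0 Q0 XA YA H; rewrite ler_pdivlMr//.
have H1 : g * (P ^+ 2 + Q ^+ 2) <= B * A * (P + Q).
  rewrite (le_trans H)// -mulrA ler_wpM2l// mulrDr lerD// ler_wpM2r//.
have H2 : g * (P + Q) ^+ 2 <= 2 * A * B * (P + Q).
  have : g * (P + Q) ^+ 2 <= g * (2 * (P ^+ 2 + Q ^+ 2)).
    rewrite ler_pM2l//; have := sqr_ge0 (P - Q); nra.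
  by nra.
have [S0|S0] := eqVneq (P + Q) 0.
  have -> : P = 0 by apply/eqP; rewrite eq_le P0 andbT -S0 lerDl.
  by rewrite mul0r !mulr_ge0.
have Sgt : 0 < P + Q by rewrite lt_def S0 addr_ge0.
move: H2; rewrite expr2 mulrA ler_pM2r// => H2.
by rewrite mulrC (le_trans _ H2)// ler_pM2l// lerDl.
Qed.

Section Perturbation.
Variables (R : realType) (Omega : set (R * R)).
Hypotheses (oO : open Omega) (bO : bounded_set Omega).

Local Notation essbounded := (essbounded Omega).

(** Energy estimate for [us], then coercivity applied to [u - us] through the
    residual identity.  The lower bound [g] and the size [T] of the perturbation
    are measured relative to [Lam] for the second coefficient, whence a constant
    free of [Lam]. *)
Lemma perturbation_estimate : exists2 C0 : R, 0 < C0 &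
  forall (g T Lam : R) (m l m' l' : R * R -> R) (f L : vfield R -> R) (u us : vfield R),
  0 < g -> 0 <= T -> 0 <= Lam -> essbounded m -> essbounded l -> essbounded m' -> essbounded l' ->
  {ae leb2 R, forall x, Omega x -> g <= m x} ->
  {ae leb2 R, forall x, Omega x -> Lam * g <= l x} ->
  {ae leb2 R, forall x, Omega x -> g <= m' x} ->
  {ae leb2 R, forall x, Omega x -> Lam * g <= l' x} ->
  ae_bounded_on (leb2 R) Omega T (fun x => m' x - m x) ->
  ae_bounded_on (leb2 R) Omega (Lam * T) (fun x => l' x - l x) ->
  in_dual Omega f -> in_dual Omega L ->
  is_solution Omega m l f u -> is_solution Omega m' l' f us ->
  `|L u - L us| <= C0 / g ^+ 2 * T * norm_dual Omega f * norm_dual Omega L.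
Proof.
(* [16 = 2 * 8] comes from [sqr_le_bilinear] and [bform_le]; the load and [L]
   each contribute a square root of [K] *)
have [K K0 HK] := norm_V_sqr_le_strain oO bO; exists (16 * K); first by rewrite mulr_gt0.
move=> g T Lam m l m' l' f L u us g0 T0 Lam0 cm cl cm' cl' gm gl gm' gl' dm dl df dL.
move=> [Vu su] [Vus sus].
have Vw : in_V Omega (u - us).
  by have := in_V_linear oO bO (-1) Vus Vu; rewrite scaleN1r addrC.
have Lu := in_H1_L2field Vu.1; have Lus := in_H1_L2field Vus.1.
have Lw := in_H1_L2field Vw.1.
set F := norm_dual Omega f; set G := norm_dual Omega L.
have F0 : 0 <= F by exact: norm_dual_ge0 df Vw.
have G0 : 0 <= G by exact: norm_dual_ge0 dL Vw.
have sK := sqrtr_ge0 K.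
have normV v : in_V Omega v -> norm_V Omega v <= Num.sqrt K * strain_norm Omega v.
  move=> Vv; rewrite (norm_VE oO (in_H1_L2field Vv.1)) /strain_norm -(sqrtrM _ (ltW K0)).
  by rewrite ler_wsqrtr// HK.
have energy_us := bform_ge oO Lam0 cm' cl' gm' gl' (ltW g0) Lus.
have energy_w := bform_ge oO Lam0 cm cl gm gl (ltW g0) Lw.
have residual : bform Omega m l (u - us) (u - us) =
    bform Omega (fun x => m' x - m x) (fun x => l' x - l x) us (u - us).
  rewrite (bform_subl oO cm cl Lu Lus Lw) (bform_subc oO cm' cm cl' cl Lus Lw).
  by rewrite su// sus.
have pert := bform_le oO T0 Lam0 dm dl Lus Lw.
rewrite residual in energy_w.
have XN w : 0 <= strain_norm Omega w by exact: sqrtr_ge0.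
have YN w : 0 <= div_norm Omega Lam w by rewrite mulr_ge0// sqrtr_ge0.
have [Xus Yus] : strain_norm Omega us <= F * Num.sqrt K / g /\
    div_norm Omega Lam us <= F * Num.sqrt K / g.
  apply: sqr_le_linear => //; first exact: mulr_ge0.
  apply: (le_trans energy_us); rewrite (sus _ Vus) (le_trans (ler_norm _))//.
  by rewrite (le_trans (dual_le oO bO df Vus))// -mulrA ler_wpM2l// normV.
have A0 : 0 <= F * Num.sqrt K / g by apply: divr_ge0 (ltW g0); exact: mulr_ge0.
have Pw : strain_norm Omega (u - us) <= 2 * (F * Num.sqrt K / g) * (8 * T) / g.
  apply: (sqr_le_bilinear g0 A0 _ (XN (u - us)) (YN (u - us)) Xus Yus); first by rewrite mulr_ge0.
  by rewrite (le_trans energy_w)// (le_trans (ler_norm _)).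
rewrite -(dualB dL Vu Vus) (le_trans (dual_le oO bO dL Vw))//.
rewrite mulrC ler_wpM2r// (le_trans (normV _ Vw))//.
apply: (@le_trans _ _ (Num.sqrt K * (2 * (F * Num.sqrt K / g) * (8 * T) / g))).
  by rewrite ler_wpM2l.
rewrite -[K in leRHS](sqr_sqrtr (ltW K0)) le_eqVlt; apply/orP; left; apply/eqP.
by field; rewrite gt_eqF.
Qed.

End Perturbation.

(** * Truncated expansions *)

Section Truncation.
Variable R : realType.

Lemma nneseries_tail_lty (N : nat -> R) s : (forall j, 0 <= N j) ->
  (\sum_(0 <= j <oo) (N j)%:E < +oo)%E -> (\sum_(s <= j <oo) (N j)%:E < +oo)%E.
Proof.
move=> N0; apply: le_lt_trans.
have N0' k : (0 <= (N k)%:E)%E by rewrite lee_fin.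
rewrite (nneseries_split 0 s (fun k _ => N0' k)) leeDr//.
by apply: sume_ge0 => i _.
Qed.

(** The series of differences vanishes below [s] and is dominated by [N] above. *)
Lemma truncated_series_dist (N a : nat -> R) s : (forall j, `|a j| <= N j) ->
  (\sum_(0 <= j <oo) (N j)%:E < +oo)%E ->
  `|limn (series (fun j => if (j < s)%N then a j else 0)) - limn (series a)|
    <= fine (\sum_(s <= j <oo) (N j)%:E).
Proof.
move=> aN Noo; pose b j := if (j < s)%N then a j else 0; rewrite -[fun j => if _ then a j else 0]/b.
have N0 j : 0 <= N j by rewrite (le_trans _ (aN j)).
have cvgN := nnseries_is_cvg N0 Noo.
have cvg_dom (c : nat -> R) : (forall j, `|c j| <= N j) -> cvgn (series c).
  by move=> cN; apply: normed_cvg; apply: series_le_cvg cvgN => // n; exact: normr_ge0.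
have bN j : `|b j| <= N j by rewrite /b; case: ifP => // _; rewrite normr0.
have Tfin : (\sum_(s <= j <oo) (N j)%:E)%E \is a fin_num.
  rewrite ge0_fin_numE; first exact: nneseries_tail_lty.
  by apply: nneseries_ge0 => j _ _; rewrite lee_fin.
have -> : limn (series b) - limn (series a) = limn (series (b - a)).
  by apply: esym; apply: lim_seriesB; exact: cvg_dom.
have cbd : cvgn (series (b - a)) by apply: is_cvg_seriesB; exact: cvg_dom.
have bound n : `|series (b - a) n| <= fine (\sum_(s <= j <oo) (N j)%:E).
  rewrite seriesEnat /=.
  apply: (@le_trans _ _ (\sum_(s <= j < n) N j)); last first.
    rewrite -lee_fin fineK// -sumEFin.
    by apply: nneseries_lim_ge => j _ _; rewrite lee_fin.
  have small k : (k <= s)%N -> \sum_(0 <= j < k) (b - a) j = 0.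
    move=> ks; rewrite big_nat big1// => j /andP[_ jk].
    by rewrite !fctE /b (leq_trans jk ks) subrr.
  have [ns|sn] := leqP n s; first by rewrite small// normr0 sumr_ge0.
  rewrite (big_cat_nat (n := s))//=; last exact: ltnW.
  rewrite small// add0r (le_trans (ler_norm_sum _ _ _))//.
  apply: ler_sum_nat => j /andP[sj _].
  by rewrite !fctE /b ltnNge sj/= sub0r normrN.
rewrite ler_norml; apply/andP; split.
- by apply: limr_ge => //; apply: nearW => n; have := bound n; rewrite ler_norml => /andP[].
- by apply: limr_le => //; apply: nearW => n; have := bound n; rewrite ler_norml => /andP[].
Qed.

Lemma ae_le_Lnormy d (T : measurableType d) (mu : {measure set T -> \bar R}) (f : T -> R) :
  {ae mu, forall x, (`|f x|%:E <= Lnorm mu +oo (EFin \o f))%E}.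
Proof.
rewrite unlock; case: ifPn => [_|]; first exact: ess_sup_ge.
(* a null measure has norm 0, and every set is negligible *)
rewrite -leNgt => mu0; exists setT; split=> //.
by apply/eqP; rewrite eq_le mu0 measure_ge0.
Qed.

Variables (Omega : set (R * R)).
Hypotheses (oO : open Omega).
Local Notation plane := (measurableTypeR R * measurableTypeR R)%type.
Let mO := open_measurable2 oO.
Variables (a0 : R * R -> R) (psi : nat -> R * R -> R).
Hypotheses (a0_Loo : in_Lp Omega +oo%E a0) (psi_Loo : forall j, in_Lp Omega +oo%E (psi j)).

Lemma Loo_measurable f : in_Lp Omega +oo%E f ->
  measurable_fun Omega (f : plane -> R).
Proof.
rewrite /in_Lp inE => /andP[]; rewrite inE /= => mf _.
exact/(measurable_restrictT _ mO).
Qed.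

Lemma measurable_expansion y :
  measurable_fun Omega (expansion a0 psi y : plane -> R).
Proof.
apply: measurable_funD; first exact: Loo_measurable.
apply: (measurable_limn mO) => n.
have : measurable_fun (Omega : set plane) (fun x => \sum_(0 <= j < n) (y j * psi j x)).
  by apply: measurable_sum => j; apply: measurable_funM => //; exact: Loo_measurable.
exact.
Qed.

Lemma norm_Loo_fin j :
  norm_Lp Omega +oo (psi j) = (fine (norm_Lp Omega +oo (psi j)))%:E.
Proof.
rewrite fineK// ge0_fin_numE ?Lnorm_ge0//.
by have := psi_Loo j; rewrite /in_Lp inE => /andP[_]; rewrite inE.
Qed.

Lemma norm_Loo_ge0 j : 0 <= fine (norm_Lp Omega +oo (psi j)).
Proof. by rewrite fine_ge0// Lnorm_ge0. Qed.

Hypothesis psi_sum : (\sum_(0 <= j <oo) norm_Lp Omega +oo (psi j) < +oo)%E.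

Lemma tail_Linf_fin s :
  tail_Linf Omega psi s = (fine (tail_Linf Omega psi s))%:E.
Proof.
rewrite fineK// ge0_fin_numE; last by apply: nneseries_ge0 => j _ _; exact: Lnorm_ge0.
have := psi_sum; rewrite /tail_Linf.
under eq_eseriesr do rewrite norm_Loo_fin.
move=> /(nneseries_tail_lty s norm_Loo_ge0).
by under [in X in _ -> X]eq_eseriesr do rewrite norm_Loo_fin.
Qed.

Lemma tail_Linf_ge0 s : 0 <= fine (tail_Linf Omega psi s).
Proof. by rewrite fine_ge0// nneseries_ge0// => j _ _; exact: Lnorm_ge0. Qed.

(** Outside a null set all the inequalities with the essential suprema hold at
    once, and there the series converges absolutely. *)
Lemma truncated_expansion_bound y s : in_U y ->
  ae_bounded_on (leb2 R) Omega (fine (tail_Linf Omega psi s))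
    (fun x => expansion a0 psi (truncate s y) x - expansion a0 psi y x).
Proof.
move=> Uy; split; first by apply: measurable_funB; exact: measurable_expansion.
have /ae_foralln := fun j => ae_le_Lnormy (leb2 R) (psi j \_ Omega).
apply: filterS => x psix Ox.
pose N j := fine (norm_Lp Omega +oo (psi j)).
have psiN j : `|psi j x| <= N j.
  have : (`|(psi j \_ Omega) x|%:E <= norm_Lp Omega +oo (psi j))%E by exact: psix.
  by rewrite norm_Loo_fin lee_fin patchE mem_set.
have yN j : `|y j * psi j x| <= N j.
  rewrite normrM (le_trans _ (psiN j))// ler_piMl// ler_norml.
  by have /andP[? ?] := Uy j; apply/andP; split; lra.
have Noo : (\sum_(0 <= j <oo) (N j)%:E < +oo)%E.
  by have := psi_sum; under eq_eseriesr do rewrite norm_Loo_fin.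
rewrite /tail_Linf; under eq_eseriesr do rewrite norm_Loo_fin.
have := truncated_series_dist s yN Noo.
rewrite /expansion opprD addrACA subrr add0r.
congr (`|limn (series _) - _| <= _); apply/funext => j.
by rewrite /truncate; case: ifP => // _; rewrite mul0r.
Qed.

End Truncation.

(** * Decay of the tails *)

(** Stechkin's inequality.  Let [S] be the sum of the powers [a j `^ p].
    Monotonicity gives [s * a s `^ p <= S]; writing [a j] as the product of
    [a j `^ (1 - p)] and [a j `^ p] and bounding the first factor by its value at
    [s], the tail is at most [a s `^ (1 - p) * S], hence at most
    [(S / s) `^ (p^-1 - 1) * S]. *)
Lemma nonincreasing_tail_rate (R : realType) (a : nat -> R) (p : R) :
  0 < p < 1 -> (forall j, 0 <= a j) ->
  (forall i j, (i <= j)%N -> a j <= a i) ->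
  (\sum_(0 <= j <oo) (a j `^ p)%:E < +oo)%E ->
  exists2 K, 0 <= K & forall s, (0 < s)%N ->
    (\sum_(s <= j <oo) (a j)%:E <= (K * rate p s)%:E)%E.
Proof.
move=> /andP[p0 p1] a0 a_dec aS.
have ap0 j : 0 <= a j `^ p by exact: powR_ge0.
set S := fine (\sum_(0 <= j <oo) (a j `^ p)%:E)%E.
have Sfin : ((\sum_(0 <= j <oo) (a j `^ p)%:E)%E = S%:E).
  by rewrite fineK// ge0_fin_numE// nneseries_ge0// => j _ _; rewrite lee_fin.
have sumS n : \sum_(0 <= j < n) a j `^ p <= S.
  rewrite -lee_fin -Sfin -sumEFin.
  by apply: nneseries_lim_ge => j _ _; rewrite lee_fin.
have S0 : 0 <= S by have := sumS 0%N; rewrite big_nil.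
have split_pow j : a j = a j `^ (1 - p) * a j `^ p.
  by rewrite -powRD ?subrK ?powRr1// oner_eq0.
exists (S `^ (p^-1 - 1) * S); first by rewrite mulr_ge0// powR_ge0.
move=> s s0.
have sR : 0 < s%:R :> R by rewrite ltr0n.
have as_le : a s `^ p <= S / s%:R.
  rewrite ler_pdivlMr// mulr_natr (le_trans _ (sumS s))//.
  rewrite -[X in _ *+ X]subn0 -sumr_const_nat; apply: ler_sum_nat => j /andP[_ js].
  by apply: ge0_ler_powR; rewrite ?nnegrE ?(ltW p0)//; apply: a_dec; exact: ltnW.
have as_rate : a s `^ (1 - p) <= S `^ (p^-1 - 1) * rate p s.
  have -> : a s `^ (1 - p) = (a s `^ p) `^ (p^-1 - 1).
    by rewrite -powRrM mulrBr mulr1 divff// gt_eqF.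
  have -> : S `^ (p^-1 - 1) * rate p s = (S / s%:R) `^ (p^-1 - 1).
    rewrite powRM ?invr_ge0// ?ltW// /rate -(opprB p^-1 1) powRN; congr (_ * _).
    by rewrite -[s%:R^-1]powR_inv1 ?ltW// -powRrM mulN1r powRN.
  apply: ge0_ler_powR; rewrite ?nnegrE ?divr_ge0// ?subr_ge0.
  by rewrite invf_ge1// ltW.
apply: lime_le; first by apply: is_cvg_nneseries => j _ _; rewrite lee_fin.
apply: nearW => n; rewrite sumEFin lee_fin.
apply: (@le_trans _ _ (a s `^ (1 - p) * \sum_(s <= j < n) a j `^ p)).
  rewrite mulr_sumr; apply: ler_sum_nat => j /andP[sj _].
  rewrite [leLHS]split_pow ler_wpM2r//.
  by apply: ge0_ler_powR; rewrite ?nnegrE ?subr_ge0 ?(ltW p1)//; exact: a_dec.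
rewrite mulrAC ler_pM ?powR_ge0 ?sumr_ge0//.
have [ns|sn] := leqP n s; first by rewrite big_geq.
rewrite (le_trans _ (sumS n))// [leRHS](big_cat_nat (n := s))//=; last exact: ltnW.
by rewrite lerDr sumr_ge0.
Qed.

(** Absolute values, as nothing forces the given constants to be nonnegative, and
    the summand 1 to make the resulting constant positive. *)
Lemma Ctilde_le_rates (R : realType) (Omega : set (R * R))
    (psi phi : nat -> R * R -> R) (p q A B : R) (s1 s2 : nat) :
  (tail_Linf Omega psi s1 <= (A * rate p s1)%:E)%E ->
  (tail_Linf Omega phi s2 <= (B * rate q s2)%:E)%E ->
  (Ctilde Omega psi phi s1 s2
     <= ((`|A| + `|B| + 1) * (rate p s1 + rate q s2))%:E)%E.
Proof.
move=> tA tB; apply: (le_trans (leeD tA tB)); rewrite -EFinD lee_fin.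
have rp : 0 <= rate p s1 by exact: powR_ge0.
have rq : 0 <= rate q s2 by exact: powR_ge0.
rewrite mulrDr lerD// ler_wpM2r// (le_trans (ler_norm _))//.
  by rewrite -addrA lerDl addr_ge0.
by rewrite (addrC `|A|) -addrA lerDl addr_ge0.
Qed.

Lemma truncate_in_U (R : realType) (y : nat -> R) s : in_U y -> in_U (truncate s y).
Proof.
by move=> Uy j; rewrite /truncate; case: ifP => // _; rewrite oppr_lt0 invr_gt0 ltr0n.
Qed.

Lemma tail_Linf_rate (R : realType) (Omega : set (R * R)) (psi : nat -> R * R -> R) (p : R) :
  (forall j, in_Lp Omega +oo%E (psi j)) -> 0 < p < 1 ->
  (forall i j, (i <= j)%N ->
     norm_Lp Omega +oo (psi j) <= norm_Lp Omega +oo (psi i))%E ->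
  (\sum_(0 <= j <oo) (norm_Lp Omega +oo (psi j) `^ p) < +oo)%E ->
  exists2 K, 0 <= K & forall s, (0 < s)%N -> (tail_Linf Omega psi s <= (K * rate p s)%:E)%E.
Proof.
move=> psi_Loo p01 dec sum_p.
have [||K K0 HK] := @nonincreasing_tail_rate R (fun j => fine (norm_Lp Omega +oo (psi j))) p p01
   (fun j => norm_Loo_ge0 Omega psi j).
- by move=> i j ij; rewrite -lee_fin -!norm_Loo_fin//; exact: dec.
- have := sum_p; under eq_eseriesr do rewrite norm_Loo_fin// poweR_EFin.
  exact.
exists K => // s s0; rewrite /tail_Linf; under eq_eseriesr do rewrite norm_Loo_fin//.
exact: HK.
Qed.

Lemma expansion_coef (R : realType) (Omega : set (R * R)) (a0 : R * R -> R)
    (psi : nat -> R * R -> R) : open Omega ->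
  in_Lp Omega +oo%E a0 -> (forall j, in_Lp Omega +oo%E (psi j)) ->
  bounded_coef Omega (expansion a0 psi) ->
  exists2 amin : R, 0 < amin & forall y, in_U y ->
    essbounded Omega (expansion a0 psi y) /\
    {ae leb2 R, forall x, Omega x -> amin <= expansion a0 psi y x}.
Proof.
move=> oO a0_Loo psi_Loo [amin [amax [amin0 amax0 bnd]]].
exists amin => // y Uy; split.
  exists amax; split; first exact: measurable_expansion.
  apply: (@ae_on_impl _ _ _ (leb2 R) Omega _ _ _ (bnd y Uy)) => x _ /andP[lo hi].
  by rewrite ger0_norm// (le_trans (ltW amin0)).
by apply: (@ae_on_impl _ _ _ (leb2 R) Omega _ _ _ (bnd y Uy)) => x _ /andP[].
Qed.

Theorem theorem4p1 (R : realType) (Omega : set (R * R))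
    (mu0 lhat0 : R * R -> R) (psi phi : nat -> R * R -> R) :
  polygonal_domain Omega ->
  orthogonal_basis_L2 Omega psi ->
  orthogonal_basis_L2 Omega phi ->
  in_Lp Omega +oo%E mu0 ->
  in_Lp Omega +oo%E lhat0 ->
  (forall j, in_Lp Omega +oo%E (psi j)) ->
  (forall j, in_Lp Omega +oo%E (phi j)) ->
  (\sum_(0 <= j <oo) norm_Lp Omega +oo (psi j) < +oo)%E ->
  (\sum_(0 <= j <oo) norm_Lp Omega +oo (phi j) < +oo)%E ->
  bounded_coef Omega (expansion mu0 psi) ->
  bounded_coef Omega (expansion lhat0 phi) ->
  [/\ exists C : R, 0 < C /\
        forall (Lam : R) (f L : vfield R -> R) (y z : nat -> R) (s1 s2 : nat)
               (u us : vfield R),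
          1 <= Lam -> in_dual Omega f -> in_dual Omega L ->
          in_U y -> in_U z ->
          is_solution Omega (expansion mu0 psi y) (lame_lambda Lam lhat0 phi z) f u ->
          is_solution Omega (expansion mu0 psi (truncate s1 y))
            (lame_lambda Lam lhat0 phi (truncate s2 z)) f us ->
          (`|L u - L us|%:E <=
             C%:E * Ctilde Omega psi phi s1 s2
               * (norm_dual Omega f)%:E * (norm_dual Omega L)%:E)%E,
      forall p q Cp Cq : R, 0 < p < 1 -> 0 < q < 1 ->
        exists Cpq : R, 0 < Cpq /\
          forall s1 s2 : nat, (0 < s1)%N -> (0 < s2)%N ->
            (tail_Linf Omega psi s1 <= (Cp * rate p s1)%:E)%E ->
            (tail_Linf Omega phi s2 <= (Cq * rate q s2)%:E)%E ->
            (Ctilde Omega psi phi s1 s2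
               <= (Cpq * (rate p s1 + rate q s2))%:E)%E &
      forall p q : R, 0 < p < 1 -> 0 < q < 1 ->
        (forall i j, (i <= j)%N ->
           norm_Lp Omega +oo (psi j) <= norm_Lp Omega +oo (psi i))%E ->
        (forall i j, (i <= j)%N ->
           norm_Lp Omega +oo (phi j) <= norm_Lp Omega +oo (phi i))%E ->
        (\sum_(0 <= j <oo) (norm_Lp Omega +oo (psi j) `^ p) < +oo)%E ->
        (\sum_(0 <= j <oo) (norm_Lp Omega +oo (phi j) `^ q) < +oo)%E ->
        exists Cpq : R, 0 < Cpq /\
          forall s1 s2 : nat, (0 < s1)%N -> (0 < s2)%N ->
            (Ctilde Omega psi phi s1 s2
               <= (Cpq * (rate p s1 + rate q s2))%:E)%E].
Proof.
move=> [_ oO _ bO _] _ _ mu0_Loo lhat0_Loo psi_Loo phi_Loo psi_sum phi_sum mu_bnd lhat_bnd.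
split; last 2 first.
- move=> p q Cp Cq p01 q01; exists (`|Cp| + `|Cq| + 1).
  by split=> [|s1 s2 _ _]; [rewrite ltr_wpDl ?addr_ge0|exact: Ctilde_le_rates].
- move=> p q p01 q01 psi_dec phi_dec psi_p phi_q.
  have [A A0 HA] := tail_Linf_rate psi_Loo p01 psi_dec psi_p.
  have [B B0 HB] := tail_Linf_rate phi_Loo q01 phi_dec phi_q.
  exists (`|A| + `|B| + 1); split; first by rewrite ltr_wpDl ?addr_ge0.
  by move=> s1 s2 s10 s20; apply: Ctilde_le_rates; [exact: HA|exact: HB].
have [C0 C00 estimate] := perturbation_estimate oO bO.
have [mumin mumin0 mu_coef] := expansion_coef oO mu0_Loo psi_Loo mu_bnd.
have [lmin lmin0 l_coef] := expansion_coef oO lhat0_Loo phi_Loo lhat_bnd.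
(* a lower bound for both coefficients, the second relative to [Lam] *)
pose g := Num.min mumin lmin.
have g0 : 0 < g by rewrite lt_min mumin0.
exists (C0 / g ^+ 2); split; first by rewrite divr_gt0// exprn_gt0.
move=> Lam f L y z s1 s2 u us Lam1 df dL Uy Uz sol sol_s.
have Lam0 : 0 <= Lam by rewrite (le_trans ler01).
have Uys := truncate_in_U s1 Uy; have Uzs := truncate_in_U s2 Uz.
set t1 := fine (tail_Linf Omega psi s1); set t2 := fine (tail_Linf Omega phi s2).
have t10 : 0 <= t1 by exact: tail_Linf_ge0.
have t20 : 0 <= t2 by exact: tail_Linf_ge0.
rewrite /Ctilde tail_Linf_fin// (tail_Linf_fin phi_Loo phi_sum) -EFinD -!EFinM lee_fin.
have mu_g y' : in_U y' -> {ae leb2 R, forall x, Omega x -> g <= expansion mu0 psi y' x}.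
  move=> /mu_coef[_]; apply: (@ae_on_impl _ _ _ (leb2 R) Omega) => x _ lo.
  by rewrite (le_trans _ lo)// ge_min lexx.
have l_g z' : in_U z' ->
    {ae leb2 R, forall x, Omega x -> Lam * g <= lame_lambda Lam lhat0 phi z' x}.
  move=> /l_coef[_]; apply: (@ae_on_impl _ _ _ (leb2 R) Omega) => x _ lo.
  by rewrite ler_wpM2l// (le_trans _ lo)// ge_min lexx orbT.
have l_cf z' : in_U z' -> essbounded Omega (lame_lambda Lam lhat0 phi z').
  by move=> /l_coef[+ _]; exact: essboundedZ.
have [mdiff dmu] := truncated_expansion_bound oO mu0_Loo psi_Loo psi_sum s1 Uy.
have [ldiff dla] := truncated_expansion_bound oO lhat0_Loo phi_Loo phi_sum s2 Uz.
apply: (estimate g (t1 + t2) Lam _ _ _ _ f L u us g0 _ Lam0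
  (mu_coef y Uy).1 (l_cf z Uz) (mu_coef _ Uys).1 (l_cf _ Uzs)
  (mu_g y Uy) (l_g z Uz) (mu_g _ Uys) (l_g _ Uzs) _ _ df dL sol sol_s).
- exact: addr_ge0.
- split=> //; apply: (@ae_on_impl _ _ _ (leb2 R) Omega _ _ _ dmu) => x _ le1.
  by rewrite (le_trans le1)// lerDl.
- have E : (fun x => lame_lambda Lam lhat0 phi (truncate s2 z) x - lame_lambda Lam lhat0 phi z x) =
    (fun x => Lam * (expansion lhat0 phi (truncate s2 z) x - expansion lhat0 phi z x)).
    by apply/funext => x; rewrite /lame_lambda mulrBr.
  rewrite E; split; first exact: measurable_funM.
  apply: (@ae_on_impl _ _ _ (leb2 R) Omega _ _ _ dla) => x _ le2.
  by rewrite normrM (ger0_norm Lam0) ler_wpM2l// (le_trans le2)// lerDr.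
Qed.
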